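(* Consider a parallel network with path set $\mathcal P$ in which every path has a single bottleneck, as described in the context, and in which no two paths have the same free-flow latency, together with given human-driven and autonomous vehicle demands $\bar\lambda^{\mathrm h},\bar\lambda^{\mathrm a}$. (i) A routing that minimizes total latency when all users (both human drivers and autonomous users) are selfish, i.e. a network equilibrium of minimum total latency, can be computed in $O(|\mathcal P|^3\log|\mathcal P|)$ time. (ii) A routing that minimizes total latency when human drivers are selfish and autonomous users are controlled can also be computed in $O(|\mathcal P|^3\log|\mathcal P|)$ time.
   Context: Network. A parallel network with a single origin and destination and a finite set $\mathcal P$ of paths; vehicles choose a path on leaving the first cell (an infinite-capacity queue), paths do not share cells, except for the downstream-most cell, which has infinite capacity. Path $p$ is a chain of cells $\mathcal I_p$: the first $m^{\mathrm n}_p$ cells have $b^{\mathrm n}_p$ lanes and jam density $\bar n^{\mathrm n}_p$, followed by bottleneck cells with $b^{\mathrm b}_p<b^{\mathrm n}_p$ lanes; $r_p=b^{\mathrm b}_p/b^{\mathrm n}_p\in(0,1)$. All cells of $p$ have free-flow velocity $\bar v_p$ and nominal headways $h^{\mathrm h}_p$ (human-driven) and $h^{\mathrm a}_p$ (autonomous). The free-flow latency of $p$ is $a_p=|\mathcal I_p|/\bar v_p$. Steady state of a path. If path $p$ carries constant human-driven flow $f^{\mathrm h}_p\ge0$ and autonomous flow $f^{\mathrm a}_p\ge 0$, its autonomy level is $\alpha_p=f^{\mathrm a}_p/(f^{\mathrm h}_p+f^{\mathrm a}_p)$. Its capacity (the minimum capacity of its cells, i.e. that of the bottleneck cells) is $\bar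 F_p(\alpha_p)=\bar v_p b^{\mathrm b}_p/(\alpha_p h^{\mathrm a}_p+(1-\alpha_p)h^{\mathrm h}_p)$, and $f^{\mathrm h}_p+f^{\mathrm a}_p\le \bar F_p(\alpha_p)$ is required. The per-cell latency due to congestion is $\ell^{\mathrm c}_p(\alpha_p)=\frac{(1-r_p)\bar n^{\mathrm n}_p(\alpha_p h^{\mathrm a}_p+(1-\alpha_p)h^{\mathrm h}_p)}{r_p\bar v_p b^{\mathrm n}_p}$. If the flow is strictly below capacity the path is in free-flow (has no congested cells) with latency $\ell_p=a_p$; if the flow equals capacity, the possible steady-state latencies are $\ell_p=a_p+\gamma_p\ell^{\mathrm c}_p(\alpha_p)$, where $\gamma_p$ is the length of the congested portion; cells are considered small enough that $\gamma_p$ is treated as a continuous variable in $[0,m^{\mathrm n}_p]$. Routing and equilibrium. A routing assigns flows $(f^{\mathrm h}_p,f^{\mathrm a}_p)_{p\in\mathcal P}$ with $\sum_p f^{\mathrm h}_p=\bar\lambda^{\mathrm h}$, $\sum_p f^{\mathrm a}_p=\bar\lambda^{\mathrm a}$, together with a steady state ($\gamma_p$) on each path. It is a network equilibrium if every path carrying selfish users has latency at most that of every other path ($\ell_p\le\ell_{p'}$ whenever $p$ carries selfish users and $p'\in\mathcal P$). In (i) both vehicle types are selfish; in (ii) only human drivers are selfish, and the autonomous routing is chosen by a central planner. Minimization is over network equilibria with the given demand, and the total latency of a routing is $\sum_{p}(f^{\mathrm h}_p+f^{\mathrm a}_p)\ell_p$. This notion of equilibrium corresponds to constant routing under the drivers'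 route-choice dynamics started from an initial choice distribution with positive human-driven and autonomous flow on each path. *)

(* Defs.v *)
(* MathComp-Analysis *)
From HB Require Import structures.
From mathcomp Require Import all_boot all_order all_algebra.
From mathcomp Require Import boolp classical_sets reals topology normedtype.
From mathcomp Require Import landau exp.

Set Implicit Arguments.
Unset Strict Implicit.
Unset Printing Implicit Defensive.

Import Order.TTheory GRing.Theory Num.Theory.

Local Open Scope ring_scope.

(** ** Parallel networks of single-bottleneck paths *)

(* Among the [cells] cells of a path, the first [cells_n] have [lanes_n] lanes
   and jam density [jam_n]; the bottleneck cells, with [lanes_b] lanes,
   follow. *)
Record bpath (R : realType) := BPath {
  velocity : R;
  headway_h : R;
  headway_a : R;
  cells : nat;
  cells_n : nat;
  lanes_n : nat;
  lanes_b : nat;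
  jam_n : R;
  velocity_gt0 : 0 < velocity;
  headway_h_gt0 : 0 < headway_h;
  headway_a_gt0 : 0 < headway_a;
  cells_n_gt0 : (0 < cells_n)%N;
  cells_n_lt : (cells_n < cells)%N;
  lanes_b_gt0 : (0 < lanes_b)%N;
  lanes_b_lt : (lanes_b < lanes_n)%N;
  jam_n_gt0 : 0 < jam_n }.

Section Path.
Variables (R : realType) (p : bpath R).
Implicit Types fh fa alpha gamma : R.

Definition freeflow_latency : R := (cells p)%:R / velocity p.

Definition lane_ratio : R := (lanes_b p)%:R / (lanes_n p)%:R.

Definition mean_headway alpha : R :=
  alpha * headway_a p + (1 - alpha) * headway_h p.

Definition capacity alpha : R :=
  velocity p * (lanes_b p)%:R / mean_headway alpha.

Definition congestion_latency alpha : R :=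
  (1 - lane_ratio) * jam_n p * mean_headway alpha
  / (lane_ratio * velocity p * (lanes_n p)%:R).

(* Equal to 0 when both flows vanish. The value is then irrelevant: the capacity
   is positive at every level in [0, 1], so an empty path is in free-flow. *)
Definition autonomy fh fa : R := fa / (fh + fa).

Definition path_latency fh fa gamma : R :=
  freeflow_latency + gamma * congestion_latency (autonomy fh fa).

Definition steady_state fh fa gamma : Prop :=
  [/\ 0 <= fh, 0 <= fa,
      fh + fa <= capacity (autonomy fh fa),
      0 <= gamma <= (cells_n p)%:R
    & fh + fa < capacity (autonomy fh fa) -> gamma = 0].

End Path.

Definition network (R : realType) (n : nat) := 'I_n -> bpath R.

Record routing (R : realType) (n : nat) := Routing {
  flow_h : 'I_n -> R;
  flow_a : 'I_n -> R;
  congested : 'I_n -> R (* length of the congested portion of each path *) }.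

(* [selfish fh fa] says that a path with flows [fh] and [fa] carries selfish
   users. *)
Definition all_selfish (R : realType) (fh fa : R) : bool := (0 < fh) || (0 < fa).
Definition humans_selfish (R : realType) (fh fa : R) : bool := 0 < fh.

Section Equilibrium.
Variables (R : realType) (n : nat) (P : network R n).
Implicit Types (x y : routing R n) (dh da : R) (selfish : R -> R -> bool).

Definition latency x (i : 'I_n) : R :=
  path_latency (P i) (flow_h x i) (flow_a x i) (congested x i).

Definition total_latency x : R :=
  \sum_(i < n) (flow_h x i + flow_a x i) * latency x i.

Definition feasible dh da x : Prop :=
  [/\ \sum_(i < n) flow_h x i = dh, \sum_(i < n) flow_a x i = da
    & forall i, steady_state (P i) (flow_h x i) (flow_a x i) (congested x i)].

Definition equilibrium selfish dh da x : Prop :=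
  feasible dh da x /\
  forall i j, selfish (flow_h x i) (flow_a x i) -> latency x i <= latency x j.

Definition best_equilibrium selfish dh da x : Prop :=
  equilibrium selfish dh da x /\
  forall y, equilibrium selfish dh da y -> total_latency x <= total_latency y.

End Equilibrium.

(** ** A real random-access machine

   The machine is given as a language of while programs with a unit-cost
   semantics. The memory has finitely many (those named in the program)
   unbounded arrays of natural numbers and of exact real numbers; cells are
   addressed by natural numbers computed at run time. Every array access,
   constant, arithmetic operation, comparison, connective and command costs one
   step. Naturals have only addition and truncated subtraction, and the only
   constants are natural numbers, so that neither large integers nor real
   constants can encode precomputed data. *)

Inductive nexp : Type :=
| NConst of nat
| NRead of nat & nexp
| NAdd of nexp & nexp
| NSub of nexp & nexp.

(* Real division by zero yields 0. *)
Inductive rexp : Type :=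
| RConst of nat
| RRead of nat & nexp
| RAdd of rexp & rexp
| RSub of rexp & rexp
| RMul of rexp & rexp
| RDiv of rexp & rexp.

Inductive bexp : Type :=
| BLeN of nexp & nexp
| BLeR of rexp & rexp
| BNot of bexp
| BAnd of bexp & bexp.

Inductive cmd : Type :=
| Skip
| NWrite of nat & nexp & nexp (* array, index, value *)
| RWrite of nat & nexp & rexp
| Seq of cmd & cmd
| If of bexp & cmd & cmd
| While of bexp & cmd.

Record store (R : realType) := Store {
  nmem : nat -> nat -> nat; (* array, index *)
  rmem : nat -> nat -> R }.

Section Machine.
Variable R : realType.
Implicit Types s : store R.

Definition upd (T : Type) (m : nat -> nat -> T) (a i : nat) (v : T) :
    nat -> nat -> T :=
  fun b j => if (b == a) && (j == i) then v else m b j.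

Fixpoint neval s (e : nexp) : nat :=
  match e with
  | NConst k => k
  | NRead a e1 => nmem s a (neval s e1)
  | NAdd e1 e2 => (neval s e1 + neval s e2)%N
  | NSub e1 e2 => (neval s e1 - neval s e2)%N
  end.

Fixpoint reval s (e : rexp) : R :=
  match e with
  | RConst k => k%:R
  | RRead a e1 => rmem s a (neval s e1)
  | RAdd e1 e2 => reval s e1 + reval s e2
  | RSub e1 e2 => reval s e1 - reval s e2
  | RMul e1 e2 => reval s e1 * reval s e2
  | RDiv e1 e2 => reval s e1 / reval s e2
  end.

Fixpoint beval s (b : bexp) : bool :=
  match b with
  | BLeN e1 e2 => (neval s e1 <= neval s e2)%N
  | BLeR e1 e2 => reval s e1 <= reval s e2
  | BNot b1 => ~~ beval s b1
  | BAnd b1 b2 => beval s b1 && beval s b2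
  end.

Fixpoint ncost (e : nexp) : nat :=
  match e with
  | NConst _ => 1
  | NRead _ e1 => (ncost e1).+1
  | NAdd e1 e2 | NSub e1 e2 => (ncost e1 + ncost e2).+1
  end.

Fixpoint rcost (e : rexp) : nat :=
  match e with
  | RConst _ => 1
  | RRead _ e1 => (ncost e1).+1
  | RAdd e1 e2 | RSub e1 e2 | RMul e1 e2 | RDiv e1 e2 =>
      (rcost e1 + rcost e2).+1
  end.

Fixpoint bcost (b : bexp) : nat :=
  match b with
  | BLeN e1 e2 => (ncost e1 + ncost e2).+1
  | BLeR e1 e2 => (rcost e1 + rcost e2).+1
  | BNot b1 => (bcost b1).+1
  | BAnd b1 b2 => (bcost b1 + bcost b2).+1
  end.

(* [exec c s s' t]: started in [s], [c] halts in [s'] after exactly [t] steps. *)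
Inductive exec : cmd -> store R -> store R -> nat -> Prop :=
| ExecSkip s : exec Skip s s 1
| ExecNWrite s a e1 e2 :
    exec (NWrite a e1 e2) s
      (Store (upd (nmem s) a (neval s e1) (neval s e2)) (rmem s))
      (ncost e1 + ncost e2).+1
| ExecRWrite s a e1 e2 :
    exec (RWrite a e1 e2) s
      (Store (nmem s) (upd (rmem s) a (neval s e1) (reval s e2)))
      (ncost e1 + rcost e2).+1
| ExecSeq c1 c2 s s1 s2 t1 t2 :
    exec c1 s s1 t1 -> exec c2 s1 s2 t2 ->
    exec (Seq c1 c2) s s2 (t1 + t2).+1
| ExecIf b c1 c2 s s1 t :
    exec (if beval s b then c1 else c2) s s1 t ->
    exec (If b c1 c2) s s1 (bcost b + t).+1
| ExecWhileF b c s :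
    ~~ beval s b -> exec (While b c) s s (bcost b).+1
| ExecWhileT b c s s1 s2 t1 t2 :
    beval s b -> exec c s s1 t1 -> exec (While b c) s1 s2 t2 ->
    exec (While b c) s s2 (bcost b + t1 + t2).+1.

Lemma exec_det c s s1 s2 t1 t2 :
  exec c s s1 t1 -> exec c s s2 t2 -> s1 = s2 /\ t1 = t2.
Proof.
move=> H; elim: H s2 t2 => {c s s1 t1};
  intros; match goal with H : exec _ _ ?s ?t |- _ = ?s /\ _ = ?t =>
    inversion H; subst end;
  repeat match goal with
  | IH : forall _ _, exec ?c ?s _ _ -> _, H : exec ?c ?s _ _ |- _ =>
      case: (IH _ _ H) => ? ?; clear H; subst
  | H1 : is_true (~~ ?b), H2 : is_true ?b |- _ => by rewrite H2 in H1
  end; by [].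
Qed.

(** ** Input and output conventions

   Input: cell 0 of natural array 0 holds the number of paths; real arrays
   0 to 7 hold the path parameters, indexed by path; cells 0 and 1 of real
   array 8 hold the demands. Every other cell is 0.
   Output: cell 0 of natural array 1 is 1 if a routing is returned and 0
   otherwise; real arrays 9 to 11 hold the routing, indexed by path. *)

Definition path_data (p : bpath R) (a : nat) : R :=
  match a with
  | 0 => velocity p
  | 1 => headway_h p
  | 2 => headway_a p
  | 3 => (cells p)%:R
  | 4 => (cells_n p)%:R
  | 5 => (lanes_n p)%:R
  | 6 => (lanes_b p)%:R
  | 7 => jam_n p
  | _ => 0
  end.

Definition input_store n (P : network R n) (dh da : R) : store R :=
  Store (fun a i => if (a == 0%N) && (i == 0%N) then n else 0%N)
    (fun a i => if a == 8%N then [:: dh; da]`_i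
                else if insub i is Some k then path_data (P k) a else 0).

Definition output_flag s : nat := nmem s 1 0.

Definition output_routing n s : routing R n :=
  Routing (fun i => rmem s 9 i) (fun i => rmem s 10 i) (fun i => rmem s 11 i).

(* Demands that no equilibrium serves must be reported as such. *)
Definition correct_output (selfish : R -> R -> bool) n (P : network R n)
    (dh da : R) s : Prop :=
  (output_flag s = 1%N /\
     best_equilibrium P selfish dh da (output_routing n s)) \/
  (output_flag s = 0%N /\
     forall x, ~ equilibrium P selfish dh da x).

(* One program solves the problem for networks of every size [n], within [T n]
   steps. *)
Definition computes_best_equilibrium (selfish : R -> R -> bool) (c : cmd)
    (T : nat -> nat) : Prop :=
  forall n (P : network R n) (dh da : R),
    injective (fun i => freeflow_latency (P i)) -> 0 <= dh -> 0 <= da ->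
    exists s t, [/\ exec c (input_store P dh da) s t, (t <= T n)%N
                  & correct_output selfish P dh da s].

End Machine.

(* Main.v *)
Require Import Defs.
From mathcomp Require Import all_boot all_order all_algebra.
From mathcomp Require Import boolp classical_sets reals topology normedtype.
From mathcomp Require Import landau exp.
From mathcomp Require Import ring lra zify.
Import GRing.Theory Num.Theory numFieldNormedType.Exports.
Import Order.TTheory.
Set Implicit Arguments.
Unset Strict Implicit.
Unset Printing Implicit Defensive.
Local Open Scope classical_set_scope.
Local Open Scope ring_scope.

(** Let [L] be the minimum latency over all paths at some equilibrium. A path
    whose free-flow latency is below [L] must be at capacity, since otherwise
    it would be in free-flow and beat [L]. Lower [L] to the largest free-flow
    latency [a_k] that does not exceed it and keep all flows: the queues of the
    faster paths get shorter, so they still fit, path [k] becomes queue-free,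
    and no latency increases. Hence only the [n] levels [L = a_k] compete
    ([equilibrium_plan], with converse [plan_equilibrium]).

    At a fixed level the problem is linear. Weighting flows by their headways
    turns the capacity constraint into
    [headway_h * x + headway_a * y <= supply], for a human flow [x] and an
    autonomous flow [y]. On a faster path equality holds, and
    the condition that the queue raising the latency to [L] fits in the cells
    upstream of the bottleneck cuts the segment of admissible [(x, y)] by a
    half-plane. On a path of free-flow latency [L] the pair ranges over a
    triangle. On a slower path only autonomous users can travel, and only if
    they are controlled; each unit [z] there costs [a_i - L] more than on the
    other paths. The total latency is [L] times the demand plus these extra
    costs, so as much autonomous flow as possible should travel at latency [L].
    When all users are selfish the room on slower paths is 0, which makes the
    first part of the theorem an instance of the problem of the second part.

    For the human demand [dh], the autonomous flow that fits at latency [L]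
    fills an interval, because the admissible pairs form convex sets. Each end
    of the interval, and then the distribution of the rest over the slower
    paths, is a fractional knapsack problem, solved by filling the paths in the
    order of their marginal costs ([greedy_price]); interpolating between the
    two ends reaches every value in between ([best_plan], [plan_best]). The
    greedy amount of path [i] has a closed form, the clamp of the demand left
    by the paths before and after it, so it takes one pass over the paths for
    each [i] and no sorting. One level costs a constant number of double loops,
    and all levels together cost [O(n^3)], which is within [O(n^3 ln n)].

    The algorithm is written in a language of counted loops. Such a program has
    a total semantics [run], and its translation to the machine halts within
    [steps], a polynomial whose degree is the nesting depth of the loops
    ([exec_run], [steps_poly]). *)

(** * Programs with counted loops *)

(** [Loop v c] runs [c] once for each value of cell 0 of natural array [v] below
    the value of cell 0 of natural array 0, which holds the number of paths. *)
Inductive prog : Type :=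
| Nop
| SetN of nat & nexp & nexp
| SetR of nat & nexp & rexp
| Then of prog & prog
| Cond of bexp & prog & prog
| Loop of nat & prog.

Definition cell0 (a : nat) : nexp := NRead a (NConst 0).
Definition more (v : nat) : bexp := BNot (BLeN (cell0 0) (cell0 v)).
Definition incr (v : nat) : cmd := NWrite v (NConst 0) (NAdd (cell0 v) (NConst 1)).

Fixpoint compile (c : prog) : cmd :=
  match c with
  | Nop => Skip
  | SetN a e1 e2 => NWrite a e1 e2
  | SetR a e1 e2 => RWrite a e1 e2
  | Then c1 c2 => Seq (compile c1) (compile c2)
  | Cond b c1 c2 => If b (compile c1) (compile c2)
  | Loop v c1 => Seq (NWrite v (NConst 0) (NConst 0))
                   (While (more v) (Seq (compile c1) (incr v)))
  end.

(** Both branches of a conditional are charged, which loses a factor that does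
    not depend on the input. The constants of a loop are the costs of testing,
    incrementing and initializing its counter. *)
Fixpoint steps (c : prog) (n : nat) : nat :=
  match c with
  | Nop => 1
  | SetN _ e1 e2 => (ncost e1 + ncost e2).+1
  | SetR _ e1 e2 => (ncost e1 + rcost e2).+1
  | Then c1 c2 => (steps c1 n + steps c2 n).+1
  | Cond b c1 c2 => (bcost b + (steps c1 n + steps c2 n)).+1
  | Loop _ c1 => (n * (steps c1 n + 14) + 11)%N
  end.

Fixpoint depth (c : prog) : nat :=
  match c with
  | Then c1 c2 | Cond _ c1 c2 => maxn (depth c1) (depth c2)
  | Loop _ c1 => (depth c1).+1
  | _ => 0
  end.

Fixpoint nwrites (c : prog) : seq nat :=
  match c with
  | SetN a _ _ => [:: a]
  | Then c1 c2 | Cond _ c1 c2 => nwrites c1 ++ nwrites c2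
  | Loop v c1 => v :: nwrites c1
  | _ => [::]
  end.

Fixpoint rwrites (c : prog) : seq nat :=
  match c with
  | SetR a _ _ => [:: a]
  | Then c1 c2 | Cond _ c1 c2 => rwrites c1 ++ rwrites c2
  | Loop _ c1 => rwrites c1
  | _ => [::]
  end.

(** Loop bodies that write neither their counter nor the number of paths make
    every loop a genuine bounded iteration, which gives [run] its meaning. *)
Fixpoint safe (c : prog) : bool :=
  match c with
  | SetN a _ _ => a != 0%N
  | Then c1 c2 | Cond _ c1 c2 => safe c1 && safe c2
  | Loop v c1 => [&& v != 0%N, v \notin nwrites c1 & safe c1]
  | _ => true
  end.

(** A loop multiplies the cost of its body by the number of paths, and every
    other construct only adds costs. *)
Lemma steps_poly (c : prog) :
  exists C : nat, forall n, (steps c n <= C * n.+1 ^ depth c)%N.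
Proof.
have both (f g : nat -> nat) d1 d2 k :
    (exists C, forall n, f n <= C * n.+1 ^ d1)%N ->
    (exists C, forall n, g n <= C * n.+1 ^ d2)%N ->
    (exists C, forall n, (k + (f n + g n)).+1 <= C * n.+1 ^ maxn d1 d2)%N.
  move=> [C1 h1] [C2 h2]; exists (C1 + C2 + k.+1)%N; move=> n.
  have x1 : (n.+1 ^ d1 <= n.+1 ^ maxn d1 d2)%N by rewrite leq_pexp2l ?leq_maxl.
  have x2 : (n.+1 ^ d2 <= n.+1 ^ maxn d1 d2)%N by rewrite leq_pexp2l ?leq_maxr.
  have x0 : (0 < n.+1 ^ maxn d1 d2)%N by rewrite expn_gt0.
  have y1 := leq_trans (h1 n) (leq_mul (leqnn C1) x1).
  have y2 := leq_trans (h2 n) (leq_mul (leqnn C2) x2).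
  have y0 := leq_pmulr k.+1 x0.
  rewrite !mulnDl; lia.
elim: c => [|a e1 e2|a e1 e2|c1 IH1 c2 IH2|b c1 IH1 c2 IH2|v c1 [C h]] /=.
- by exists 1%N.
- by exists (ncost e1 + ncost e2).+1; move=> n; rewrite expn0 muln1.
- by exists (ncost e1 + rcost e2).+1; move=> n; rewrite expn0 muln1.
- by have [C h] := both _ _ _ _ 0 IH1 IH2; exists C.
- exact: both.
- exists (C + 25)%N; move=> n; rewrite expnS.
  have := h n; have : (0 < n.+1 ^ depth c1)%N by rewrite expn_gt0.
  move: (n.+1 ^ depth c1)%N (steps c1 n) => x y; nia.
Qed.

Section Run.
Variable R : realType.
Implicit Types (s : store R) (c : prog).

Definition setn s a i k := Store (upd (nmem s) a i k) (rmem s).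
Definition setr s a i x := Store (nmem s) (upd (rmem s) a i x).
Definition tick v s := setn s v 0 (nmem s v 0 + 1).

Fixpoint run c s : store R :=
  match c with
  | Nop => s
  | SetN a e1 e2 => setn s a (neval s e1) (neval s e2)
  | SetR a e1 e2 => setr s a (neval s e1) (reval s e2)
  | Then c1 c2 => run c2 (run c1 s)
  | Cond b c1 c2 => if beval s b then run c1 s else run c2 s
  | Loop v c1 =>
      iter (nmem s 0 0) (fun s1 => tick v (run c1 s1)) (setn s v 0 0)
  end.

Lemma upd_other T (m : nat -> nat -> T) a i x b :
  b != a -> upd m a i x b = m b.
Proof. by move=> ab; apply/funext => j; rewrite /upd (negbTE ab). Qed.

Lemma nmem_run c s a : a \notin nwrites c -> nmem (run c s) a = nmem s a.
Proof.
elim: c s => //= [b e1 e2|c1 IH1 c2 IH2|b c1 IH1 c2 IH2|v c1 IH1] s.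
- by rewrite inE => ab; rewrite upd_other.
- by rewrite mem_cat negb_or => /andP[n1 n2]; rewrite IH2 // IH1.
- by rewrite mem_cat negb_or => /andP[n1 n2]; case: ifP => _; [exact: IH1|exact: IH2].
- rewrite inE negb_or => /andP[av n1].
  by elim: (nmem s 0 0) => [|k IH] /=; rewrite upd_other // IH1.
Qed.

Lemma rmem_run c s a : a \notin rwrites c -> rmem (run c s) a = rmem s a.
Proof.
elim: c s => //= [b e1 e2|c1 IH1 c2 IH2|b c1 IH1 c2 IH2|v c1 IH1] s.
- by rewrite inE => ab; rewrite upd_other.
- by rewrite mem_cat negb_or => /andP[n1 n2]; rewrite IH2 // IH1.
- by rewrite mem_cat negb_or => /andP[n1 n2]; case: ifP => _; [exact: IH1|exact: IH2].
- by move=> n1; elim: (nmem s 0 0) => [|k IH] //=; rewrite IH1.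
Qed.

Lemma safe_nwrites c : safe c -> 0%N \notin nwrites c.
Proof.
elim: c => //= [a _ _|c1 IH1 c2 IH2|_ c1 IH1 c2 IH2|v c1 IH1].
- by rewrite inE eq_sym.
- by case/andP=> w1 w2; rewrite mem_cat negb_or IH1 ?IH2.
- by case/andP=> w1 w2; rewrite mem_cat negb_or IH1 ?IH2.
- by case/and3P=> v0 _ w1; rewrite inE negb_or eq_sym v0 IH1.
Qed.

Lemma nmem_tick v s a : a != v -> nmem (tick v s) a = nmem s a.
Proof. exact: upd_other. Qed.

Lemma exec_run c s n :
  safe c -> nmem s 0 0 = n ->
  exists t, exec (compile c) s (run c s) t /\ (t <= steps c n)%N.
Proof.
elim: c s => [|a e1 e2|a e1 e2|c1 IH1 c2 IH2|b c1 IH1 c2 IH2|v c1 IH1] s /=.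
- by move=> _ _; exists 1%N; split=> //; exact: ExecSkip.
- by move=> _ _; eexists; split; [exact: ExecNWrite|].
- by move=> _ _; eexists; split; [exact: ExecRWrite|].
- case/andP=> w1 w2 sn; have [t1 [x1 l1]] := IH1 _ w1 sn.
  have [|t2 [x2 l2]] := IH2 (run c1 s) w2.
    by rewrite nmem_run ?safe_nwrites.
  exists (t1 + t2).+1; split; first exact: ExecSeq x1 x2.
  by rewrite ltnS leq_add.
- case/andP=> w1 w2 sn.
  suff [t [x l]] : exists t, exec (if beval s b then compile c1 else compile c2) s
      (if beval s b then run c1 s else run c2 s) t /\
      (t <= steps c1 n + steps c2 n)%N.
    exists (bcost b + t).+1; split; first exact: ExecIf.
    by rewrite ltnS leq_add.
  case: ifP => _.
    have [t [x l]] := IH1 _ w1 sn; exists t; split=> //; lia.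
  have [t [x l]] := IH2 _ w2 sn; exists t; split=> //; lia.
- case/and3P=> v0 vc w1 sn.
  have n0 : 0%N \notin nwrites c1 by exact: safe_nwrites.
  suff loop m s' : nmem s' 0 0 = n -> (nmem s' v 0 + m)%N = n ->
      exists t, exec (While (more v) (Seq (compile c1) (incr v))) s'
        (iter m (fun s1 => tick v (run c1 s1)) s') t /\
        (t <= m * (steps c1 n + 14) + 7)%N.
    have [||t [x l]] := loop n (setn s v 0 0); rewrite /setn /=.
    + by rewrite upd_other // eq_sym.
    + by rewrite /upd !eqxx.
    exists (3 + t).+1; split; last by rewrite /=; lia.
    rewrite sn; exact: (ExecSeq (ExecNWrite s v (NConst 0) (NConst 0)) x).
  elim: m s' => [|m IHm] s' s'n vm.
    exists 7%N; split=> //; apply: (@ExecWhileF _ (more v)) => /=.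
    by rewrite s'n; lia.
  have [t1 [x1 l1]] := IH1 _ w1 s'n.
  have e0 : nmem (tick v (run c1 s')) 0 = nmem s' 0.
    by rewrite nmem_tick 1?eq_sym // nmem_run.
  have ev : nmem (tick v (run c1 s')) v 0 = (nmem s' v 0 + 1)%N.
    by rewrite /= /upd !eqxx /= nmem_run.
  have [||t2 [x2 l2]] := IHm (tick v (run c1 s')).
  + by rewrite e0.
  + by rewrite ev; lia.
  rewrite iterSr.
  exists (6 + (t1 + 6).+1 + t2).+1; split; last by nia.
  apply: (@ExecWhileT _ (more v)); last exact: x2.
    by rewrite /= s'n; lia.
  exact: (ExecSeq x1 (ExecNWrite _ v (NConst 0) (NAdd (cell0 v) (NConst 1)))).
Qed.

(** The frame of a computation that writes at most the real arrays [rs] and the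
    natural arrays [ns]. *)
Definition same_off (rs ns : seq nat) s s' :=
  (forall a, a \notin rs -> rmem s' a = rmem s a) /\
  (forall a, a \notin ns -> nmem s' a = nmem s a).

(** The frame is part of what the step may assume, so that an invariant only
    has to speak of the arrays that the loop changes. *)
Lemma run_loop (I : nat -> store R -> Prop) v c s n :
  safe (Loop v c) -> nmem s 0 0 = n -> I 0 (setn s v 0 0) ->
  (forall (i : 'I_n) s', same_off (rwrites c) (v :: nwrites c) s s' ->
     nmem s' v 0 = i -> I i s' -> I i.+1 (tick v (run c s'))) ->
  I n (run (Loop v c) s).
Proof.
move=> /= /and3P[v0 vc w1] sn I0 IS; rewrite sn.
suff: forall m, (m <= n)%N ->
    let s' := iter m (fun s1 => tick v (run c s1)) (setn s v 0 0) in
    [/\ same_off (rwrites c) (v :: nwrites c) s s', nmem s' v 0 = m & I m s'].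
  by move=> /(_ n (leqnn n)) [].
elim=> [_|m IHm lt_mn] /=.
  split=> //; last by rewrite /upd !eqxx.
  split=> // a; rewrite inE negb_or => /andP[av _].
  by rewrite /= upd_other.
have [[fr fn] vm Im] := IHm (ltnW lt_mn).
split; last exact: (IS (Ordinal lt_mn)).
- split=> a an; first by rewrite /= rmem_run // fr.
  have := an; rewrite inE negb_or => /andP[av ac].
  by rewrite nmem_tick // nmem_run // fn.
- by rewrite /= /upd !eqxx /= nmem_run // vm addn1.
Qed.

Lemma run_loop_map v c s n b (val : 'I_n -> R) :
  safe (Loop v c) -> nmem s 0 0 = n ->
  (forall (i : 'I_n) s', same_off (rwrites c) (v :: nwrites c) s s' ->
     nmem s' v 0 = i -> rmem s' b i = rmem s b i ->
     forall j, rmem (run c s') b j = if j == i then val i else rmem s' b j) ->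
  forall i : 'I_n, rmem (run (Loop v c) s) b i = val i.
Proof.
move=> safe_c sn step.
suff: forall i : 'I_n, rmem (run (Loop v c) s) b i =
    if (i < n)%N then val i else rmem s b i.
  by move=> h i; rewrite h ltn_ord.
apply: (run_loop (I := fun m s' => forall i : 'I_n,
  rmem s' b i = if (i < m)%N then val i else rmem s b i)) => //.
move=> i s' fr vi IH j /=; rewrite (step i) //; last by rewrite IH ltnn.
case: (eqVneq (j : nat) i) => [/val_inj->|ji]; first by rewrite ltnSn.
by rewrite IH [in RHS]ltnS [in RHS]leq_eqVlt (negbTE ji).
Qed.

(** All reads of array [b] in [e] are at indices satisfying [q]. With [q] the
    test for the loop counter, [e] is unaffected by the other writes that the
    loop makes to [b]; with [q] empty, [e] does not read [b] at all. *)
Fixpoint rreads (b : nat) (q : pred nexp) (e : rexp) : bool :=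
  match e with
  | RConst _ => true
  | RRead a i => (a == b) ==> q i
  | RAdd e1 e2 | RSub e1 e2 | RMul e1 e2 | RDiv e1 e2 =>
      rreads b q e1 && rreads b q e2
  end.

Fixpoint breads (b : nat) (q : pred nexp) (e : bexp) : bool :=
  match e with
  | BLeN _ _ => true
  | BLeR e1 e2 => rreads b q e1 && rreads b q e2
  | BNot e1 => breads b q e1
  | BAnd e1 e2 => breads b q e1 && breads b q e2
  end.

Lemma neval_ext s s' e : (nmem s =2 nmem s') -> neval s e = neval s' e.
Proof.
move=> h; elim: e => //= [a e ->|e1 -> e2 ->|e1 -> e2 ->] //.
Qed.

Lemma reval_ext s s' b (q : pred nexp) e :
  nmem s =2 nmem s' -> (forall a, a != b -> rmem s a =1 rmem s' a) ->
  (forall i, q i -> rmem s b (neval s i) = rmem s' b (neval s i)) ->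
  rreads b q e -> reval s e = reval s' e.
Proof.
move=> hn hr hq; elim: e => //= [a i|e1 IH1 e2 IH2|e1 IH1 e2 IH2
  |e1 IH1 e2 IH2|e1 IH1 e2 IH2]; try by case/andP=> /IH1-> /IH2->.
rewrite -(neval_ext i hn); case: eqVneq => [-> /hq //|ab _]; exact: hr.
Qed.

Lemma beval_ext s s' b (q : pred nexp) e :
  nmem s =2 nmem s' -> (forall a, a != b -> rmem s a =1 rmem s' a) ->
  (forall i, q i -> rmem s b (neval s i) = rmem s' b (neval s i)) ->
  breads b q e -> beval s e = beval s' e.
Proof.
move=> hn hr hq; elim: e => //= [e1 e2 _|e1 e2|e IH /IH->//|e1 IH1 e2 IH2].
- by rewrite -!(neval_ext _ hn).
- by case/andP=> /(reval_ext hn hr hq)-> /(reval_ext hn hr hq)->.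
- by case/andP=> /IH1-> /IH2->.
Qed.

Definition is_cell0 (v : nat) (e : nexp) : bool :=
  if e is NRead w (NConst 0) then w == v else false.

Lemma is_cell0E v e : is_cell0 v e -> e = cell0 v.
Proof. by case: e => //= w [] // [] // /eqP->. Qed.

(** [update] and [sum_into] are the only loops over single arrays that the
    algorithm needs: a pointwise conditional assignment and a sum. *)
Definition update v b cnd e := Loop v (Cond cnd (SetR b (cell0 v) e) Nop).

Definition sum_into v b e :=
  Then (SetR b (NConst 0) (RConst 0))
    (Loop v (SetR b (NConst 0) (RAdd (RRead b (NConst 0)) e))).

Lemma same_off_setn v b s s' i : same_off [:: b] [:: v] s s' ->
  nmem s' v 0 = i -> (forall j, j != 0%N -> nmem s' v j = nmem s v j) ->
  nmem s' =2 nmem (setn s v 0 i).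
Proof.
move=> [_ fn] vi vj a j /=; rewrite /upd.
have [->|av] := eqVneq a v; last by rewrite fn ?inE.
by have [->|j0] := eqVneq j 0%N; rewrite ?vi ?vj.
Qed.

(** Iteration [i] sees the initial value of entry [i], because it is the only
    iteration that writes this entry. The first conjunct is needed since
    expressions may read any cell of the array of the counter. *)
Lemma run_update_all v b cnd e s n :
  v != 0%N -> nmem s 0 0 = n ->
  breads b (is_cell0 v) cnd -> rreads b (is_cell0 v) e ->
  (forall j, j != 0%N -> nmem (run (update v b cnd e) s) v j = nmem s v j) /\
  (forall j, rmem (run (update v b cnd e) s) b j =
     if (j < n)%N && beval (setn s v 0 j) cnd then reval (setn s v 0 j) e
     else rmem s b j).
Proof.
move=> v0 sn lc le.
pose val j := if beval (setn s v 0 j) cnd then reval (setn s v 0 j) e else rmem s b j.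
suff: (forall j, j != 0%N -> nmem (run (update v b cnd e) s) v j = nmem s v j) /\
      (forall j, rmem (run (update v b cnd e) s) b j =
                 if (j < n)%N then val j else rmem s b j).
  by case=> ? h; split=> // j; rewrite h; case: ltnP.
apply: (run_loop (I := fun m s' =>
   (forall j, j != 0%N -> nmem s' v j = nmem s v j) /\
   (forall j, rmem s' b j = if (j < m)%N then val j else rmem s b j))) => //.
- by rewrite /= v0.
- by split=> // j j0; rewrite /= /upd (negbTE j0) andbF.
move=> i s' fr vi [IHv IH].
have hn : nmem s' =2 nmem (setn s v 0 i) by exact: same_off_setn fr vi IHv.
have hr a : a != b -> rmem s' a =1 rmem (setn s v 0 i) a.
  by move=> ab j; rewrite fr.1 //= ?cats0 ?inE.
have hq k : is_cell0 v k -> rmem s' b (neval s' k) = rmem (setn s v 0 i) b (neval s' k).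
  by move/is_cell0E=> -> /=; rewrite vi IH ltnn.
split=> j.
  by move=> j0; rewrite /= /upd (negbTE j0) andbF /=; case: ifP => _ /=; rewrite IHv.
rewrite /= (beval_ext hn hr hq lc) (reval_ext hn hr hq le).
have [->|ji] := eqVneq j i.
  rewrite ltnSn /val; case: ifP => _ /=; last by rewrite IH ltnn.
  by rewrite /upd vi !eqxx.
rewrite ltnS leq_eqVlt (negbTE ji) /= -IH.
by case: ifP => _ //=; rewrite /upd vi (negbTE ji) andbF.
Qed.

Lemma run_update v b cnd e s n (i : 'I_n) :
  v != 0%N -> nmem s 0 0 = n ->
  breads b (is_cell0 v) cnd -> rreads b (is_cell0 v) e ->
  rmem (run (update v b cnd e) s) b i =
    if beval (setn s v 0 i) cnd then reval (setn s v 0 i) e else rmem s b i.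
Proof. by move=> v0 sn lc le; rewrite (run_update_all v0 sn lc le).2 ltn_ord. Qed.

Lemma run_sum_into v b e s n :
  v != 0%N -> nmem s 0 0 = n -> rreads b xpred0 e ->
  rmem (run (sum_into v b e) s) b 0 = \sum_(i < n) reval (setn s v 0 i) e.
Proof.
move=> v0 sn le; rewrite [run _ _]/=; set s0 := setr s b 0 0.
suff: (forall j, j != 0%N ->
        nmem (run (Loop v (SetR b (NConst 0) (RAdd (RRead b (NConst 0)) e))) s0) v j = nmem s v j) /\
      rmem (run (Loop v (SetR b (NConst 0) (RAdd (RRead b (NConst 0)) e))) s0) b 0 =
        \sum_(i < n) reval (setn s v 0 i) e by case.
apply: (run_loop (I := fun m s' =>
   (forall j, j != 0%N -> nmem s' v j = nmem s v j) /\
   rmem s' b 0 = \sum_(i < m) reval (setn s v 0 i) e)) => //.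
- by rewrite /= v0.
- split=> [j j0|]; first by rewrite /= /upd (negbTE j0) andbF.
  by rewrite big_ord0 /= /upd !eqxx.
move=> i s' fr vi [IHv IH].
have hn : nmem s' =2 nmem (setn s v 0 i).
  move=> a j; rewrite /= /upd.
  have [->|av] := eqVneq a v; last by rewrite fr.2 ?inE.
  by have [->|j0] := eqVneq j 0%N; rewrite ?vi ?IHv.
have hr a : a != b -> rmem s' a =1 rmem (setn s v 0 i) a.
  by move=> ab j; rewrite fr.1 //= ?inE ?upd_other.
split=> [j j0|]; first by rewrite /= /upd (negbTE j0) andbF IHv.
by rewrite big_ord_recr /= (reval_ext hn hr _ le) // -IH /upd !eqxx.
Qed.

End Run.

(** * Fractional knapsack by a greedy closed form *)

Section Greedy.
Variables (R : realFieldType) (n : nat).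
Implicit Types (key lo hi t : 'I_n -> R) (d : R) (i j : 'I_n).

(** Ties are broken by index: the closed form needs a strict total order. *)
Definition before key j i :=
  (key j < key i) || ((key j <= key i) && (j < i)%N).

(** Start from all lower bounds and raise the entries to their upper bounds in
    the order of [key] until the sum reaches [d]. When the turn of [i] comes,
    the entries before it are full and those after it are still at their lower
    bounds, which determines its value up to clamping. The term [lo i] outside
    the sum compensates for [j = i] inside, [before] being irreflexive. *)
Definition greedy key lo hi d i : R :=
  Num.max (lo i) (Num.min (hi i)
    (lo i + d - \sum_(j < n) (if before key j i then hi j else lo j))).

Lemma before_irr key i : before key i i = false.
Proof. by rewrite /before ltxx ltnn andbF. Qed.

Lemma before_trans key : transitive (before key).
Proof.
move=> j i k /orP[h1|/andP[h1 h1']] /orP[h2|/andP[h2 h2']]; apply/orP.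
- by left; exact: lt_trans h2.
- by left; exact: lt_le_trans h2.
- by left; exact: le_lt_trans h2.
- by right; rewrite (le_trans h1 h2) (ltn_trans h1' h2').
Qed.

Lemma before_total key i j : i != j -> before key i j || before key j i.
Proof.
rewrite -val_eqE neq_ltn /before /=.
by case: (ltgtP (key i) (key j)) => //=; case: ltngtP.
Qed.

Lemma before_asym key i j : before key i j -> before key j i = false.
Proof.
move=> ij; apply/negP => ji.
by have := before_trans ij ji; rewrite before_irr.
Qed.

Definition rank key i : nat := #|[pred j | before key j i]|.

Lemma rank_lt key i j : before key i j -> (rank key i < rank key j)%N.
Proof.
move=> ij; apply/proper_card/properP; split.
  by apply/fintype.subsetP => k; rewrite !inE => /before_trans; apply.
by exists i; rewrite !inE ?before_irr.
Qed.

(** The entry at which the filling of total amount [e] stops. It is the first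
    one, by [rank], where the cumulative width reaches [e]; its predecessor, if
    there is one, gives the other inequality. *)
Lemma pivot key (u : 'I_n -> R) e :
  (forall i, 0 <= u i) -> 0 <= e <= \sum_i u i -> (0 < n)%N ->
  exists p, \sum_(j | before key j p) u j <= e <=
            u p + \sum_(j | before key j p) u j.
Proof.
move=> u0 /andP[e0 eu] n0.
have sumE p q : (forall j, before key j p = (j == q) || before key j q) ->
    \sum_(j | before key j p) u j = u q + \sum_(j | before key j q) u j.
  move=> h; rewrite (bigD1 q) /=; last by rewrite h eqxx.
  congr (_ + _); apply: eq_bigl => j; rewrite h.
  by have [->|] := eqVneq j q; rewrite ?before_irr ?andbT.
pose i0 := Ordinal n0.
case: (@arg_maxnP _ i0 xpredT (rank key) isT) => l _ lmax.
have el : e <= u l + \sum_(j | before key j l) u j.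
  apply: (le_trans eu); rewrite (bigD1 l) //= lerD2l le_eqVlt; apply/orP; left.
  apply/eqP/eq_bigl => j; case: (eqVneq j l) => [->|jl]; first by rewrite before_irr.
  have [//|lj] := orP (before_total key jl).
  by have := lmax j isT; have := rank_lt lj; lia.
case: (@arg_minnP _ l (fun p => e <= u p + \sum_(j | before key j p) u j)
  (rank key) el) => p ep pmin.
exists p; rewrite ep andbT.
case: (pickP (fun j => before key j p)) => [q0 q0p|none]; last by rewrite big1 // => j; rewrite none.
case: (@arg_maxnP _ q0 (fun j => before key j p) (rank key) q0p) => q qp qmax.
rewrite (sumE p q).
  rewrite leNgt; apply/negP => /ltW /pmin.
  by have := rank_lt qp; lia.
move=> j; case: (eqVneq j q) => [->//|jq] /=.
apply/idP/idP => [jp|/before_trans]; last exact.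
have [//|qj] := orP (before_total key jq).
by have := qmax j jp; have := rank_lt qj; lia.
Qed.

(** Linear programming duality: the key of the pivot is the price of one unit
    of demand. Full entries have smaller keys and untouched ones larger keys,
    so every deviation [y] of an entry costs at least its price. *)
Lemma greedy_price key lo hi d :
  (forall i, lo i <= hi i) -> \sum_i lo i <= d <= \sum_i hi i -> (0 < n)%N ->
  exists p, \sum_i greedy key lo hi d i = d /\
    forall i (y : R), lo i <= y <= hi i ->
      key p * (y - greedy key lo hi d i) <= key i * (y - greedy key lo hi d i).
Proof.
move=> lohi /andP[dlo dhi] n0.
have u0 i : 0 <= hi i - lo i by rewrite subr_ge0.
have [|//|p /andP[p1 p2]] := @pivot key (fun i => hi i - lo i) (d - \sum_i lo i) u0 _.
  by rewrite sumrB; lra.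
pose U i := \sum_(j | before key j i) (hi j - lo j).
have rawE i : lo i + d - \sum_(j < n) (if before key j i then hi j else lo j)
    = lo i + (d - \sum_j lo j - U i).
  have -> : \sum_(j < n) (if before key j i then hi j else lo j) = \sum_j lo j + U i.
    rewrite /U (big_mkcond (fun j => before key j i)) -big_split.
    by apply: eq_bigr => j _ /=; case: ifP => _; lra.
  by lra.
have U_mono i j : before key i j -> U i + (hi i - lo i) <= U j.
  move=> ij; rewrite /U [leRHS](bigD1 i) //= [leLHS]addrC lerD2l.
  rewrite big_mkcond [leRHS]big_mkcond /=; apply: ler_sum => k _.
  case: (boolP (before key k i)) => [ki|_].
    rewrite (before_trans ki ij); case: eqVneq => //= ki'.
    by move: ki; rewrite ki' before_irr.
  by case: ifP => _.
rewrite -/(U p) in p1 p2.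
have gb i : before key i p -> greedy key lo hi d i = hi i.
  move=> ip; rewrite /greedy rawE; have := U_mono _ _ ip => h.
  rewrite min_l; last by lra.
  by rewrite max_r.
have ga i : before key p i -> greedy key lo hi d i = lo i.
  move=> ip; rewrite /greedy rawE; have := U_mono _ _ ip => h.
  by rewrite min_r ?max_l //; have := lohi i; lra.
have gp : greedy key lo hi d p = lo p + (d - \sum_j lo j - U p).
  by rewrite /greedy rawE min_r ?max_r //; lra.
exists p; split.
  have -> : \sum_i greedy key lo hi d i = \sum_i ((if before key i p then hi i - lo i else 0)
     + lo i + (if i == p then d - \sum_j lo j - U p else 0)).
    apply: eq_bigr => i _; case: (eqVneq i p) => [->|ip].
      by rewrite before_irr gp; lra.
    have [h|h] := orP (before_total key ip).
      by rewrite h gb //; lra.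
    by rewrite (before_asym h) ga //; lra.
  rewrite 2!big_split /= -!big_mkcond /= big_pred1_eq -/(U p); lra.
move=> i t /andP[t1 t2]; case: (eqVneq i p) => [->//|ip].
have [h|h] := orP (before_total key ip).
  rewrite gb //; apply: ler_wnM2r; first by lra.
  by case/orP: h => [/ltW|/andP[]].
rewrite ga //; apply: ler_wpM2r; first by lra.
by case/orP: h => [/ltW|/andP[]].
Qed.

Lemma greedy_box key lo hi d i :
  lo i <= hi i -> lo i <= greedy key lo hi d i <= hi i.
Proof. by move=> h; rewrite /greedy le_max lexx ge_max h ge_min lexx. Qed.

Lemma greedy_sum key lo hi d :
  (forall i, lo i <= hi i) -> \sum_i lo i <= d <= \sum_i hi i ->
  \sum_i greedy key lo hi d i = d.
Proof.
move=> lohi dlh; case: (posnP n) => [n0|n0].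
  have e (f : 'I_n -> R) : \sum_i f i = 0 by rewrite big1 // => i _; exfalso; have := ltn_ord i; lia.
  by move: dlh; rewrite !e; lra.
by have [p []] := greedy_price key lohi dlh n0.
Qed.

(** Summing [greedy_price] over the entries. A competitor that covers more
    than the demand is also no better when keys, hence the price, are
    nonnegative. *)
Lemma greedy_min key lo hi d t :
  (forall i, lo i <= hi i) -> \sum_i lo i <= d <= \sum_i hi i ->
  (forall i, lo i <= t i <= hi i) ->
  \sum_i t i = d \/ (d <= \sum_i t i /\ forall i, 0 <= key i) ->
  \sum_i key i * greedy key lo hi d i <= \sum_i key i * t i.
Proof.
move=> lohi dlh box dt; case: (posnP n) => [n0|n0].
  by rewrite !big1 // => i _; exfalso; have := ltn_ord i; lia.
have [p [sg pr]] := greedy_price key lohi dlh n0.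
rewrite -subr_ge0 -sumrB.
have : \sum_i key p * (t i - greedy key lo hi d i)
       <= \sum_i (key i * t i - key i * greedy key lo hi d i).
  by apply: ler_sum => i _; rewrite -mulrBr; exact: pr.
apply: le_trans; rewrite -mulr_sumr sumrB sg.
case: dt => [->|[dt kp]]; first by rewrite subrr mulr0.
by rewrite mulr_ge0 ?subr_ge0.
Qed.

End Greedy.

(** * The linear program of one candidate level *)

(** Of the flows travelling at the candidate level, the human flow [x] of path
    [i] lies in [[lo i, hi i]] and the autonomous flow between the affine
    functions [low0 + low1 * x] and [up0 - up1 * x]: equal functions describe a
    segment, and the zero lower function a triangle. Further autonomous flow,
    up to [spill i], can use path [i] at additional cost [extra i] per unit. *)
Record lp (R : realFieldType) (n : nat) := LP {
  lo : 'I_n -> R;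
  hi : 'I_n -> R;
  low0 : 'I_n -> R;
  low1 : 'I_n -> R;
  up0 : 'I_n -> R;
  up1 : 'I_n -> R;
  spill : 'I_n -> R;
  extra : 'I_n -> R }.

Section LinearProgram.
Variables (R : realFieldType) (n : nat) (D : lp R n) (dh da : R).

Record lp_ok : Prop := LPOk {
  lp_low_up : forall i t, lo D i <= t <= hi D i ->
    low0 D i + low1 D i * t <= up0 D i - up1 D i * t;
  lp_spill : forall i, 0 <= spill D i;
  lp_extra : forall i, 0 <= extra D i }.

Record plan (x y z : 'I_n -> R) : Prop := Plan {
  plan_box : forall i, lo D i <= x i <= hi D i;
  plan_low : forall i, low0 D i + low1 D i * x i <= y i;
  plan_up : forall i, y i <= up0 D i - up1 D i * x i;
  plan_spill : forall i, 0 <= z i <= spill D i;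
  plan_h : \sum_i x i = dh;
  plan_a : \sum_i (y i + z i) = da }.

(** [xmin] and [xmax] distribute the human demand so as to minimize and maximize
    the autonomous flow at the level; [low1] and the opposite of [up1] are the
    changes of these flows per human unit. *)
Definition xmin := greedy (low1 D) (lo D) (hi D) dh.
Definition xmax := greedy (up1 D) (lo D) (hi D) dh.
Definition fmin := \sum_i (low0 D i + low1 D i * xmin i).
Definition fmax := \sum_i (up0 D i - up1 D i * xmax i).
Definition fbest := Num.min da fmax.
(** If [fmin = fmax] this is a division by 0, whose value 0 is the right one:
    then [fbest = fmin]. *)
Definition theta := (fbest - fmin) / (fmax - fmin).

Definition best_x i := xmin i + theta * (xmax i - xmin i).
Definition best_y i := low0 D i + low1 D i * xmin i
  + theta * (up0 D i - up1 D i * xmax i - (low0 D i + low1 D i * xmin i)).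
Definition best_z := greedy (extra D) (fun=> 0) (spill D) (da - fbest).

Definition lp_feasible : bool :=
  [&& [forall i, lo D i <= hi D i], \sum_i lo D i <= dh, dh <= \sum_i hi D i,
      fmin <= da & da <= fmax + \sum_i spill D i].

Definition lp_cost (z : 'I_n -> R) := \sum_i extra D i * z i.

Hypothesis ok : lp_ok.

(** The constraints are convex, and [theta] is chosen so that the interpolated
    autonomous flow is [fbest]. *)
Lemma best_plan : lp_feasible -> plan best_x best_y best_z.
Proof.
case/and5P=> /forallP lohi dlo dhi fda dfs.
have dlh : \sum_i lo D i <= dh <= \sum_i hi D i by rewrite dlo dhi.
have bmin i : lo D i <= xmin i <= hi D i by exact: greedy_box.
have bmax i : lo D i <= xmax i <= hi D i by exact: greedy_box.
have smin : \sum_i xmin i = dh by exact: greedy_sum.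
have smax : \sum_i xmax i = dh by exact: greedy_sum.
have fmm : fmin <= fmax.
  apply: (@le_trans _ _ (\sum_i (low0 D i + low1 D i * xmax i))).
    rewrite /fmin !big_split /= lerD2l.
    by apply: greedy_min => //; left.
  by apply: ler_sum => i _; exact: lp_low_up.
have fb : fmin <= fbest by rewrite /fbest le_min fda.
have fbm : fbest <= fmax by rewrite /fbest ge_min lexx orbT.
have fba : fbest <= da by rewrite /fbest ge_min lexx.
have th0 : 0 <= theta by rewrite divr_ge0 // subr_ge0.
have th1 : theta <= 1.
  have [e|ne] := eqVneq fmax fmin.
    by rewrite /theta e subrr invr0 mulr0.
  by rewrite ler_pdivrMr ?mul1r ?subr_gt0 ?lt_neqAle 1?eq_sym ?ne //; lra.
have thE : theta * (fmax - fmin) = fbest - fmin.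
  have [e|ne] := eqVneq fmax fmin.
    by rewrite e subrr mulr0; move: e fb fbm; lra.
  by rewrite /theta divfK // subr_eq0.
have ss : 0 <= da - fbest <= \sum_i spill D i.
  have : 0 <= \sum_i spill D i by apply: sumr_ge0 => i _; exact: lp_spill.
  rewrite subr_ge0 fba /= /fbest; case: (leP da fmax) => _; lra.
split.
- move=> i; have := bmin i; have := bmax i; rewrite /best_x => /andP[a1 a2] /andP[b1 b2].
  by apply/andP; split; nra.
- move=> i; rewrite /best_x /best_y.
  by have := lp_low_up ok (bmax i); nra.
- move=> i; rewrite /best_x /best_y.
  by have := lp_low_up ok (bmin i); nra.
- by move=> i; apply: greedy_box; exact: lp_spill.
- by rewrite big_split /= -mulr_sumr sumrB smin smax subrr mulr0 addr0.
- rewrite big_split /= (greedy_sum _ (lo := fun=> 0)) //.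
  + rewrite /best_y big_split -mulr_sumr sumrB /= -/fmin -/fmax thE; lra.
  + by move=> i; exact: lp_spill.
  + by rewrite big1.
Qed.

(** In any plan the autonomous flow at the level is at most [fbest], so at
    least [da - fbest] is spilled, and [best_z] spills that amount as cheaply as
    possible. *)
Lemma plan_best x y z : plan x y z ->
  lp_feasible /\ lp_cost best_z <= lp_cost z.
Proof.
case=> box low up sp sx syz.
have lohi i : lo D i <= hi D i by have /andP[h1 h2] := box i; exact: le_trans h2.
have dlh : \sum_i lo D i <= dh <= \sum_i hi D i.
  by rewrite -sx; apply/andP; split; apply: ler_sum => i _; have /andP[] := box i.
have fy : fmin <= \sum_i y i.
  apply: (@le_trans _ _ (\sum_i (low0 D i + low1 D i * x i))); last exact: ler_sum.
  rewrite /fmin !big_split /= lerD2l.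
  by apply: greedy_min => //; left.
have yf : \sum_i y i <= fmax.
  apply: (@le_trans _ _ (\sum_i (up0 D i - up1 D i * x i))); first exact: ler_sum.
  rewrite /fmax !sumrB lerD2l lerN2.
  by apply: greedy_min => //; left.
have z0 : 0 <= \sum_i z i by apply: sumr_ge0 => i _; have /andP[] := sp i.
have zs : \sum_i z i <= \sum_i spill D i by apply: ler_sum => i _; have /andP[] := sp i.
rewrite big_split /= in syz.
have fba : \sum_i y i <= fbest by rewrite /fbest le_min yf andbT; lra.
have fba' : fbest <= da by rewrite /fbest ge_min lexx.
split.
  apply/and5P; case/andP: dlh => -> ->; split=> //; [exact/forallP|lra|lra].
apply: greedy_min => //.
- by move=> i; exact: lp_spill.
- rewrite big1 //; lra.
- by right; split; [lra|exact: lp_extra].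
Qed.

End LinearProgram.

(** * Admissible flows of a single path *)

Section PathGeometry.
Variables (R : realType) (L : R) (p : bpath R).
Implicit Types x y fh fa : R.

(** The capacity of the bottleneck for flows weighted by their headways. *)
Definition supply : R := velocity p * (lanes_b p)%:R.
(** Autonomous vehicles displaced by one human-driven vehicle on a path at
    capacity. *)
Definition slope : R := headway_h p / headway_a p.
(** Congestion latency per cell and per unit of mean headway; [max_queue] is
    that of a queue filling all cells upstream of the bottleneck. *)
Definition unit_queue : R :=
  (1 - lane_ratio p) * jam_n p / (lane_ratio p * velocity p * (lanes_n p)%:R).
Definition max_queue : R := (cells_n p)%:R * unit_queue.
Definition faster : bool := freeflow_latency p < L.
Definition slower : bool := L < freeflow_latency p.
(** The latency that a queue must add to bring the path to level [L]. *)
Definition gap : R := if faster then L - freeflow_latency p else 0.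
(** On a path at capacity, the queue adding latency [gap] fits if and only if
    [steep * x <= slack] for the human flow [x] ([slackE] with [queue_fits]).
    If the path is not faster than [L], this holds for every [x], since then
    [steep = 0] and [slack > 0]. *)
Definition slack : R := max_queue * supply - gap * (supply / headway_a p).
Definition steep : R := gap * (1 - slope).
Definition x_lo : R := if (steep < 0) && (slack < 0) then slack / steep else 0.
Definition x_all : R := if slower then 0 else supply / headway_h p.
(** An unsatisfiable constraint with [steep = 0] is encoded by the upper bound
    -1, which is below [x_lo = 0]. *)
Definition x_hi : R :=
  if (steep == 0) && (slack < 0) then -1
  else if (0 < steep) && (slack / steep < x_all) then slack / steep else x_all.

Lemma supply_gt0 : 0 < supply.
Proof. by rewrite mulr_gt0 ?velocity_gt0 // ltr0n lanes_b_gt0. Qed.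

Lemma lanes_n_gt0 : (0 < lanes_n p)%N.
Proof. exact: ltn_trans (lanes_b_gt0 p) (lanes_b_lt p). Qed.

Lemma lane_ratio_itv : 0 < lane_ratio p < 1.
Proof.
rewrite /lane_ratio divr_gt0 ?ltr0n ?lanes_b_gt0 ?lanes_n_gt0 //=.
by rewrite ltr_pdivrMr ?ltr0n ?lanes_n_gt0 // mul1r ltr_nat lanes_b_lt.
Qed.

Lemma unit_queue_gt0 : 0 < unit_queue.
Proof.
have /andP[r0 r1] := lane_ratio_itv.
apply: divr_gt0; first by rewrite mulr_gt0 ?subr_gt0 ?jam_n_gt0.
by rewrite mulr_gt0 ?ltr0n ?lanes_n_gt0 // mulr_gt0 ?velocity_gt0.
Qed.

Lemma max_queue_gt0 : 0 < max_queue.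
Proof. by rewrite mulr_gt0 ?unit_queue_gt0 // ltr0n cells_n_gt0. Qed.

Lemma congestion_latencyE alpha :
  congestion_latency p alpha = unit_queue * mean_headway p alpha.
Proof. by rewrite /congestion_latency /unit_queue mulrAC. Qed.

Lemma gap_ge0 : 0 <= gap.
Proof. by rewrite /gap /faster; case: ltP => // h; rewrite subr_ge0 ltW. Qed.

Lemma x_box x : (x_lo <= x <= x_hi) = (0 <= x <= x_all) && (steep * x <= slack).
Proof.
rewrite /x_hi /x_lo.
have xa0 : 0 <= x_all.
  rewrite /x_all; case: ifP => // _.
  by rewrite ltW // divr_gt0 ?supply_gt0 ?headway_h_gt0.
case: (ltgtP steep 0) => [s0|s0|->] /=; last first.
- rewrite mul0r [0 <= slack]leNgt; case: ltP => _ /=; last by rewrite andbT.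
  by rewrite andbF; apply/negP => /andP[]; lra.
- have -> : (steep * x <= slack) = (x <= slack / steep) by rewrite ler_pdivlMr // mulrC.
  case: (ltP (slack / steep) x_all) => h;
    by apply/andP/andP => [[h1 h2]|[/andP[h1 h2] h3]]; split=> //; try (apply/andP; split=> //); lra.
- have -> : (steep * x <= slack) = (slack / steep <= x) by rewrite ler_ndivrMr // mulrC.
  have [sl|sl] := ltP slack 0.
    have h : 0 < slack / steep by rewrite nmulr_rgt0 // invr_lt0.
    by apply/andP/andP => [[h1 h2]|[/andP[h1 h2] h3]]; split=> //; try (apply/andP; split=> //); lra.
  have h : slack / steep <= 0 by rewrite mulr_ge0_le0 // invr_le0 ltW.
  by apply/andP/andP => [[h1 h2]|[/andP[h1 h2] h3]]; split=> //; try (apply/andP; split=> //); lra.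
Qed.

Lemma mean_headway_gt0 fh fa :
  0 <= fh -> 0 <= fa -> 0 < mean_headway p (autonomy fh fa).
Proof.
move=> h0 a0; have hh := headway_h_gt0 p; have ha := headway_a_gt0 p.
have [e|ne] := eqVneq (fh + fa) 0.
  by rewrite /mean_headway /autonomy e invr0 mulr0 mul0r add0r subr0 mul1r.
have tot : 0 < fh + fa by rewrite lt_neqAle eq_sym ne; lra.
have -> : mean_headway p (autonomy fh fa) = (fh * headway_h p + fa * headway_a p) / (fh + fa).
  by rewrite /mean_headway /autonomy; field.
rewrite divr_gt0 //.
have [fh0|fh0] := eqVneq fh 0; first by rewrite fh0 mul0r add0r mulr_gt0 //; lra.
have : 0 < fh by rewrite lt_neqAle eq_sym fh0.
by nra.
Qed.

(** The mean headway is the flow-weighted average, so multiplying by the total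
    flow makes it linear; this also holds without flow, both sides being 0. *)
Lemma total_headway fh fa : 0 <= fh -> 0 <= fa ->
  (fh + fa) * mean_headway p (autonomy fh fa) =
  headway_h p * fh + headway_a p * fa.
Proof.
move=> h0 a0; have [e|ne] := eqVneq (fh + fa) 0.
  have [-> ->] : fh = 0 /\ fa = 0 by split; lra.
  by rewrite addr0 mul0r !mulr0 addr0.
by rewrite /mean_headway /autonomy; field.
Qed.

Lemma capacity_le fh fa : 0 <= fh -> 0 <= fa ->
  (fh + fa <= capacity p (autonomy fh fa)) =
  (headway_h p * fh + headway_a p * fa <= supply).
Proof.
move=> h0 a0.
by rewrite /capacity ler_pdivlMr ?mean_headway_gt0 // total_headway.
Qed.

Lemma capacity_lt fh fa : 0 <= fh -> 0 <= fa ->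
  (fh + fa < capacity p (autonomy fh fa)) =
  (headway_h p * fh + headway_a p * fa < supply).
Proof.
move=> h0 a0.
by rewrite /capacity ltr_pdivlMr ?mean_headway_gt0 // total_headway.
Qed.

Lemma congestion_gt0 fh fa : 0 <= fh -> 0 <= fa ->
  0 < congestion_latency p (autonomy fh fa).
Proof.
by move=> h0 a0; rewrite congestion_latencyE mulr_gt0 ?unit_queue_gt0 ?mean_headway_gt0.
Qed.

(** At capacity the mean headway is [supply / (fh + fa)], so a bound on the
    latency added by the longest queue becomes linear in the flows. *)
Lemma queue_fits g fh fa : 0 <= fh -> 0 <= fa ->
  headway_h p * fh + headway_a p * fa = supply ->
  (g <= (cells_n p)%:R * congestion_latency p (autonomy fh fa)) =
  (g * (fh + fa) <= max_queue * supply).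
Proof.
move=> h0 a0 full.
have tot : 0 < fh + fa.
  rewrite lt_neqAle addr_ge0 // andbT eq_sym; apply/eqP => e.
  have [e1 e2] : fh = 0 /\ fa = 0 by split; lra.
  by have := supply_gt0; rewrite -full e1 e2 !mulr0 addr0 ltxx.
rewrite -full -total_headway // congestion_latencyE -[LHS](ler_pM2r tot).
congr (_ <= _); rewrite /max_queue; ring.
Qed.

Lemma slackE x : (steep * x <= slack) =
  (gap * (x + (supply / headway_a p - slope * x)) <= max_queue * supply).
Proof.
by rewrite /slack lerBrDl; congr (_ <= _); rewrite /steep; ring.
Qed.

End PathGeometry.

(** * Equilibria and linear plans *)

Section Reduction.
Variables (R : realType) (n : nat) (P : network R n) (dh da : R) (controlled : bool).
Variable selfish : R -> R -> bool.
Hypothesis selfishE :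
  forall fh fa, selfish fh fa = (0 < fh) || (~~ controlled && (0 < fa)).

(** A path in neither class has free-flow latency exactly [L] and gets the
    triangle of all flows within capacity; on a slower path the bounds force
    [x = y = 0]. *)
Definition candidate_lp (L : R) : lp R n := {|
  lo := fun i => x_lo L (P i);
  hi := fun i => x_hi L (P i);
  low0 := fun i => if faster L (P i) then supply (P i) / headway_a (P i) else 0;
  low1 := fun i => if faster L (P i) then - slope (P i) else 0;
  up0 := fun i => if slower L (P i) then 0 else supply (P i) / headway_a (P i);
  up1 := fun i => slope (P i);
  spill := fun i =>
    if slower L (P i) then supply (P i) / headway_a (P i) * controlled%:R else 0;
  extra := fun i => if slower L (P i) then freeflow_latency (P i) - L else 0 |}.

(** Each queue is the one whose delay is [gap]; it is empty if [gap = 0]. *)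
Definition plan_routing L (x y z : 'I_n -> R) : routing R n :=
  Routing x (fun i => y i + z i)
    (fun i => gap L (P i) /
       congestion_latency (P i) (autonomy (x i) (y i + z i))).

Lemma supply_a_gt0 (p : bpath R) : 0 < supply p / headway_a p.
Proof. by rewrite divr_gt0 ?supply_gt0 ?headway_a_gt0. Qed.

Lemma headway_split (p : bpath R) fh fa :
  headway_h p * fh + headway_a p * fa = headway_a p * (slope p * fh + fa).
Proof. by rewrite /slope; field; rewrite gt_eqF ?headway_a_gt0. Qed.

Lemma supply_le (p : bpath R) fh fa :
  (headway_h p * fh + headway_a p * fa <= supply p) =
  (fa <= supply p / headway_a p - slope p * fh).
Proof.
by rewrite headway_split lerBrDl ler_pdivlMr ?headway_a_gt0 // mulrC.
Qed.

Lemma supply_eq (p : bpath R) fh fa :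
  (headway_h p * fh + headway_a p * fa == supply p) =
  (fa == supply p / headway_a p - slope p * fh).
Proof.
have ha : headway_a p != 0 by rewrite gt_eqF ?headway_a_gt0.
rewrite headway_split [RHS]eq_sym subr_eq [RHS]eq_sym [fa + _]addrC.
by rewrite -[RHS](inj_eq (mulfI ha)) mulrCA divff // mulr1.
Qed.

Lemma x_allE L (p : bpath R) x : ~~ slower L p ->
  (x <= x_all L p) = (0 <= supply p / headway_a p - slope p * x).
Proof.
move=> nf; rewrite /x_all (negbTE nf) ler_pdivlMr ?headway_h_gt0 // -supply_le.
by rewrite mulr0 addr0 mulrC.
Qed.

Lemma candidate_ok L : lp_ok (candidate_lp L).
Proof.
split=> i /=.
- move=> t; rewrite x_box => /andP[/andP[t0 tx] _].
  rewrite /faster /slower; case: ltgtP => [f|f|e]; rewrite ?mul0r.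
  + by lra.
  + have xE : x_all L (P i) = 0 by rewrite /x_all /slower f.
    have -> : t = 0 by move: tx; rewrite xE; lra.
    by rewrite mulr0; lra.
  + by move: tx; rewrite x_allE; [lra|rewrite /slower -leNgt e].
- by case: ifP => // _; rewrite mulr_ge0 ?ler0n // ltW // supply_a_gt0.
- by case: ifP => // /ltW; rewrite subr_ge0.
Qed.

Lemma gap_faster L (p : bpath R) : faster L p -> gap L p = L - freeflow_latency p.
Proof. by rewrite /gap => ->. Qed.

Lemma gap_not_faster L (p : bpath R) : ~~ faster L p -> gap L p = 0.
Proof. by rewrite /gap => /negbTE->. Qed.

Lemma faster_not_slower L (p : bpath R) : faster L p -> slower L p = false.
Proof. by rewrite /faster /slower => h; apply/negbTE; rewrite -leNgt ltW. Qed.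

(** All paths not slower than [L] have latency exactly [L]. Slower paths carry
    no selfish users: no humans at all, and autonomous users only if these are
    controlled. *)
Lemma plan_equilibrium L x y z : plan (candidate_lp L) dh da x y z ->
  equilibrium P selfish dh da (plan_routing L x y z) /\
  total_latency P (plan_routing L x y z)
    = L * (dh + da) + lp_cost (candidate_lp L) z.
Proof.
case=> box low up sp sx sa.
have x0 i : 0 <= x i by have := box i; rewrite x_box => /andP[/andP[]].
have z0 i : 0 <= z i by have /andP[] := sp i.
have y0 i : 0 <= y i.
  apply: le_trans (low i) => /=; case: ifP => [ni|_]; last by rewrite mul0r addr0.
  have := box i; rewrite x_box => /andP[/andP[_]].
  by rewrite x_allE ?faster_not_slower // mulNr.
have a0 i : 0 <= y i + z i by rewrite addr_ge0.
have slowerP i : slower L (P i) -> [/\ x i = 0, y i = 0 &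
    z i <= supply (P i) / headway_a (P i) * controlled%:R].
  move=> f; have := box i; rewrite x_box /x_all f => /andP[/andP[h1 h2] _].
  have xi : x i = 0 by apply/eqP; rewrite eq_le h1 h2.
  have := up i; have := sp i; rewrite /= f xi mulr0 => /andP[_ ->]; split=> //.
  by have := y0 i; lra.
have not_slower i : ~~ slower L (P i) -> z i = 0.
  by move=> f; have := sp i; rewrite /= (negbTE f) => h; apply/eqP; rewrite eq_le andbC.
have lat i : latency P (plan_routing L x y z) i = freeflow_latency (P i) + gap L (P i).
  by rewrite /latency /path_latency /= divfK // gt_eqF // congestion_gt0.
have fasterP i : faster L (P i) ->
    headway_h (P i) * x i + headway_a (P i) * (y i + z i) = supply (P i).
  move=> ni; apply/eqP; rewrite supply_eq not_slower ?faster_not_slower // addr0.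
  by rewrite eq_le; have := up i; have := low i; rewrite /= ni faster_not_slower // mulNr => -> ->.
have cap i : headway_h (P i) * x i + headway_a (P i) * (y i + z i) <= supply (P i).
  rewrite supply_le; have := up i => /=; case: ifP => f.
    have [-> -> zi] := slowerP _ f; rewrite !mulr0 !subr0 add0r => _.
    apply: (le_trans zi); apply: ler_piMr; first by rewrite ltW ?supply_a_gt0.
    by rewrite lern1 leq_b1.
  by rewrite not_slower ?f // addr0.
split; last first.
  rewrite /total_latency /lp_cost -sx -sa -big_split mulr_sumr -big_split /=.
  apply: eq_bigr => i _; rewrite lat.
  case: (ltgtP (freeflow_latency (P i)) L) => f.
  - by rewrite gap_faster // faster_not_slower //; ring.
  - have [-> -> _] := slowerP _ f; rewrite gap_not_faster ?/slower ?f; last by rewrite /faster -leNgt ltW.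
    by ring.
  - by rewrite gap_not_faster /slower /faster ?f ?ltxx //; ring.
split; last first.
  move=> i j; rewrite selfishE !lat => si.
  apply: (@le_trans _ _ L).
    rewrite /gap; case: ifP => ni; first by lra.
    rewrite addr0 leNgt; apply/negP => f; have [xi yi zi] := slowerP _ f.
    move: si; rewrite /= xi yi ltxx add0r /=; case: (controlled) zi => //=.
    by rewrite mulr0 => zi; rewrite ltNge zi.
  rewrite /gap; case: ifP => [|/negbT]; first by lra.
  by rewrite addr0 /faster -leNgt.
split=> // i; split=> //=.
- by rewrite capacity_le.
- have c0 := congestion_gt0 (P i) (x0 i) (a0 i).
  apply/andP; split; first by rewrite divr_ge0 ?gap_ge0 // ltW.
  rewrite ler_pdivrMr //.
  case: (boolP (faster L (P i))) => ni; last first.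
    by rewrite gap_not_faster // mulr_ge0 ?ler0n // ltW.
  rewrite queue_fits ?fasterP //.
  have := box i; rewrite x_box slackE => /andP[_]; congr (_ * (_ + _) <= _).
  by apply/esym/eqP; rewrite -supply_eq fasterP.
- rewrite capacity_lt //; case: (boolP (faster L (P i))) => ni.
    by rewrite fasterP // ltxx.
  by rewrite gap_not_faster // mul0r.
Qed.

(** Take for [L] the largest free-flow latency that does not exceed the minimum
    latency. The flows at equilibrium then satisfy all constraints of level
    [L], and each latency is at least the one that the plan assigns. *)
Lemma equilibrium_plan r : (0 < n)%N -> equilibrium P selfish dh da r ->
  exists k x y z, let L := freeflow_latency (P k) in
    plan (candidate_lp L) dh da x y z /\
    L * (dh + da) + lp_cost (candidate_lp L) z <= total_latency P r.
Proof.
move=> n0 [[sh sa st] eqr].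
pose i0 := Ordinal n0.
have h0 i : 0 <= flow_h r i by case: (st i).
have a0 i : 0 <= flow_a r i by case: (st i).
have g0 i : 0 <= congested r i by case: (st i) => _ _ _ /andP[].
have lat_ge i : freeflow_latency (P i) <= latency P r i.
  by rewrite lerDl mulr_ge0 // ltW // congestion_gt0.
case: (@Order.TotalTheory.arg_minP _ _ _ i0 xpredT (latency P r) isT) => m _ mmin.
case: (@Order.TotalTheory.arg_maxP _ _ _ m
  (fun i => freeflow_latency (P i) <= latency P r m) (fun i => freeflow_latency (P i)) (lat_ge m)) => k km kmax.
set L := freeflow_latency (P k) in km kmax *.
have latL i : L <= latency P r i by exact: le_trans (mmin i isT).
have slower_m i : slower L (P i) -> latency P r m < freeflow_latency (P i).
  move=> f; rewrite ltNge; apply/negP => /kmax h.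
  by move: f; rewrite /slower ltNge [_ <= L]h.
pose y i := if slower L (P i) then 0 else flow_a r i.
pose z i := if slower L (P i) then flow_a r i else 0.
have yz i : y i + z i = flow_a r i by rewrite /y /z; case: ifP => _; rewrite ?add0r ?addr0.
(* A selfish user would move to the path [m] of minimum latency. *)
have idle i : slower L (P i) -> flow_h r i = 0 /\ (~~ controlled -> flow_a r i = 0).
  move=> f; have ns : ~~ selfish (flow_h r i) (flow_a r i).
    apply/negP => s; have := lt_le_trans (slower_m i f) (lat_ge i).
    by rewrite ltNge eqr.
  move: ns; rewrite selfishE negb_or negb_and -!leNgt => /andP[h1 h2]; split.
    by apply/eqP; rewrite eq_le h1 h0.
  by move=> c; apply/eqP; rewrite eq_le a0 andbT; move: h2; rewrite negbK (negbTE c).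
have cap i : flow_a r i <= supply (P i) / headway_a (P i) - slope (P i) * flow_h r i.
  by rewrite -supply_le -capacity_le //; case: (st i).
(* Below capacity the path would be in free-flow, with latency below [L]. *)
have full i : faster L (P i) ->
    headway_h (P i) * flow_h r i + headway_a (P i) * flow_a r i = supply (P i).
  move=> ni; apply/eqP; rewrite eq_le supply_le cap /= leNgt; apply/negP => lt.
  have [_ _ _ _ /(_ _) gi] := st i.
  have := latL i; rewrite /latency /path_latency gi ?capacity_lt //.
  by rewrite mul0r addr0 leNgt -/(faster L (P i)) ni.
exists k, (flow_h r), y, z; split; last first.
  rewrite /total_latency /lp_cost -sh -sa -big_split mulr_sumr -big_split /=.
  apply: ler_sum => i _; rewrite /z; case: ifP => f.
    have [-> _] := idle i f; rewrite add0r.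
    have -> : L * flow_a r i + (freeflow_latency (P i) - L) * flow_a r i
       = flow_a r i * freeflow_latency (P i) by ring.
    exact: ler_wpM2l.
  rewrite mulr0 addr0 mulrC; apply: ler_wpM2l => //.
  by rewrite addr_ge0.
split=> //=.
- move=> i; rewrite x_box h0 /=; apply/andP; split.
    case: (boolP (slower L (P i))) => f; first by rewrite (idle i f).1 /x_all f.
    by rewrite x_allE //; apply: le_trans (cap i).
  case: (boolP (faster L (P i))) => ni; last first.
    rewrite /steep /slack gap_not_faster // !mul0r subr0 mulr_ge0 //.
      by rewrite ltW // max_queue_gt0.
    by rewrite ltW // supply_gt0.
  have fa : flow_a r i = supply (P i) / headway_a (P i) - slope (P i) * flow_h r i.
    by apply/eqP; rewrite -supply_eq full.
  rewrite slackE -fa.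
  rewrite -queue_fits ?full //.
  have := latL i; rewrite /latency /path_latency gap_faster // -lerBlDl => h.
  apply: le_trans h _; apply: ler_wpM2r; first by rewrite ltW // congestion_gt0.
  by case: (st i) => _ _ _ /andP[].
- move=> i; rewrite /y; case: ifP => ni; last first.
    by rewrite mul0r addr0; case: ifP.
  rewrite faster_not_slower // mulNr le_eqVlt eq_sym -supply_eq full //.
  by rewrite eqxx.
- move=> i; rewrite /y; case: ifP => f //.
  by rewrite (idle i f).1 mulr0 subr0.
- move=> i; rewrite /z; case: ifP => f; rewrite ?lexx // a0 /=.
  case: (boolP controlled) => [_|c]; last by rewrite mulr0 (idle i f).2.
  by rewrite mulr1; have := cap i; rewrite (idle i f).1 mulr0 subr0.
- by under eq_bigr do rewrite yz.
Qed.

End Reduction.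

(** * The algorithm *)

Declare Scope rexp_scope.
Delimit Scope rexp_scope with X.
Notation "x + y" := (RAdd x y) : rexp_scope.
Notation "x - y" := (RSub x y) : rexp_scope.
Notation "x * y" := (RMul x y) : rexp_scope.
Notation "x / y" := (RDiv x y) : rexp_scope.

Definition BTrue : bexp := BLeN (NConst 0) (NConst 0).
Definition BLt (e1 e2 : rexp) : bexp := BNot (BLeR e2 e1).
Definition fill v b e := update v b BTrue e.
Definition rcell0 (a : nat) : rexp := RRead a (NConst 0).
Definition entry (v a : nat) : rexp := RRead a (cell0 v).

Definition fill_if v b e1 cnd e2 : prog :=
  Then (fill v b e1) (update v b cnd e2).

Arguments run : simpl never.

Section RunLemmas.
Variable R : realType.
Implicit Types (s : store R) (c : prog).

Lemma run_then c1 c2 s : run (Then c1 c2) s = run c2 (run c1 s).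
Proof. by []. Qed.

Lemma run_setr a e1 e2 s : run (SetR a e1 e2) s = setr s a (neval s e1) (reval s e2).
Proof. by []. Qed.

Lemma run_cond b c1 c2 s :
  run (Cond b c1 c2) s = if beval s b then run c1 s else run c2 s.
Proof. by []. Qed.

Lemma run_fill v b e s n (i : 'I_n) :
  v != 0%N -> nmem s 0 0 = n -> rreads b (is_cell0 v) e ->
  rmem (run (fill v b e) s) b i = reval (setn s v 0 i) e.
Proof. by move=> v0 sn le; rewrite run_update. Qed.

Lemma run_fill_if v b e1 cnd e2 s n (i : 'I_n) :
  v != 0%N -> nmem s 0 0 = n ->
  rreads b (is_cell0 v) e1 -> breads b xpred0 cnd -> rreads b xpred0 e2 ->
  rmem (run (fill_if v b e1 cnd e2) s) b i =
    if beval (setn s v 0 i) cnd then reval (setn s v 0 i) e2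
    else reval (setn s v 0 i) e1.
Proof.
move=> v0 sn l1 lc l2; rewrite /fill_if run_then; set s1 := run _ s.
have s1n : nmem s1 0 0 = n by rewrite nmem_run //= inE eq_sym.
have [hv _] := @run_update_all _ v b BTrue e1 s n v0 sn isT l1.
have hn : nmem (setn s1 v 0 i) =2 nmem (setn s v 0 i).
  move=> a j; rewrite /= /upd; case: (eqVneq a v) => [->|av] /=; last first.
    by rewrite nmem_run //= inE.
  by case: (eqVneq j 0%N) => //= j0; exact: hv.
have hr a : a != b -> rmem (setn s1 v 0 i) a =1 rmem (setn s v 0 i) a.
  by move=> ab j; rewrite /= rmem_run //= inE.
have lx (q : pred nexp) e : rreads b xpred0 e -> rreads b q e.
  by elim: e => //= [a k|? h1 ? h2|? h1 ? h2|? h1 ? h2|? h1 ? h2];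
    [case: eqP|..] => // /andP[/h1-> /h2->].
have lb (q : pred nexp) e : breads b xpred0 e -> breads b q e.
  by elim: e => //= [? ?|? h1 ? h2] /andP[]; [move=> /lx-> /lx->|move=> /h1-> /h2->].
rewrite (run_update _ v0 s1n (lb _ _ lc) (lx _ _ l2)).
rewrite (beval_ext hn hr _ lc) // (reval_ext hn hr _ l2) //.
by rewrite (run_fill _ v0 sn).
Qed.

(** Used for minima and maxima, which the expressions of the machine lack. *)
Lemma run_guarded_setr v b cnd e s i j : nmem s v 0 = i ->
  rmem (run (Cond cnd (SetR b (cell0 v) e) Nop) s) b j =
    if (j == i) && beval s cnd then reval s e else rmem s b j.
Proof.
move=> vi; rewrite run_cond; case: ifP => _; last by rewrite andbF.
by rewrite /run /= /upd vi eqxx andbT.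
Qed.

End RunLemmas.

Definition before_exp (key : nat) : bexp :=
  BNot (BAnd (BLeR (entry 3 key) (entry 4 key))
    (BNot (BAnd (BLeR (entry 4 key) (entry 3 key))
                (BNot (BLeN (cell0 3) (cell0 4)))))).

(** Counters 3 and 4 run over the paths [i] and [j] of [greedy]. Array 24 holds
    the summands for the current [i], and cell 0 of array 25 their sum. *)
Definition greedy_prog (key lo hi dem out : nat) : prog :=
  Loop 3
    (Then (fill 4 24 (entry 4 lo))
    (Then (update 4 24 (before_exp key) (entry 4 hi))
    (Then (sum_into 4 25 (entry 4 24))
    (Then (SetR out (cell0 3) (entry 3 lo + rcell0 dem - rcell0 25)%X)
    (Then (Cond (BLeR (entry 3 hi) (entry 3 out))
                (SetR out (cell0 3) (entry 3 hi)) Nop)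
          (Cond (BLeR (entry 3 out) (entry 3 lo))
                (SetR out (cell0 3) (entry 3 lo)) Nop)))))).

Lemma run_greedy (R : realType) n (K l h : 'I_n -> R) d
    (s : store R) key lo hi dem out :
  [&& key \notin [:: 24; 25; out], lo \notin [:: 24; 25; out],
      hi \notin [:: 24; 25; out], dem \notin [:: 24; 25; out]
    & out \notin [:: 24; 25]]%N ->
  nmem s 0 0 = n ->
  (forall i : 'I_n, rmem s key i = K i) -> (forall i : 'I_n, rmem s lo i = l i) ->
  (forall i : 'I_n, rmem s hi i = h i) -> rmem s dem 0 = d ->
  forall i : 'I_n, rmem (run (greedy_prog key lo hi dem out) s) out i =
    greedy K l h d i.
Proof.
case/and5P=> keyP loP hiP demP outP sn sK sl sh sd.
apply: run_loop_map => // i s' [fr fn] vi _ j.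
have E a : a \notin [:: 24; 25; out]%N -> rmem s' a = rmem s a.
  by rewrite !inE !negb_or => /and3P[a1 a2 a3]; rewrite fr //= !inE !negb_or a1 a2 a3.
have s'n : nmem s' 0 0 = n by rewrite fn.
rewrite 5!run_then.
set s1 := run (fill _ _ _) s'; set s2 := run (update _ _ _ _) s1.
set s3 := run (sum_into _ _ _) s2.
have n0 : [/\ nmem s1 0 0 = n, nmem s2 0 0 = n & nmem s3 0 0 = n].
  by split; rewrite /s3 /s2 /s1 !nmem_run.
have n3 : [/\ nmem s1 3 0 = i, nmem s2 3 0 = i & nmem s3 3 0 = i].
  by split; rewrite /s3 /s2 /s1 !nmem_run.
have E1 a : a \notin [:: 24; 25; out]%N -> rmem s1 a = rmem s a.
  move=> aP; rewrite -E // /s1 rmem_run //=.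
  by move: aP; rewrite !inE !negb_or => /and3P[->].
have E2 a : a \notin [:: 24; 25; out]%N -> rmem s2 a = rmem s a.
  move=> aP; rewrite -E1 // /s2 rmem_run //=.
  by move: aP; rewrite !inE !negb_or => /and3P[->].
have E3 a : a \notin [:: 24; 25; out]%N -> rmem s3 a = rmem s a.
  move=> aP; rewrite -E2 // /s3 rmem_run //=.
  by move: aP; rewrite !inE !negb_or => /and3P[_ ->].
have Eo : rmem s3 out = rmem s' out.
  move: outP; rewrite !inE negb_or => /andP[u1 u2].
  by rewrite /s3 /s2 /s1 !rmem_run //= !inE ?negb_or ?u1 ?u2.
have ne a b : a \notin [:: 24; 25; b]%N -> (a == 24)%N = false.
  by rewrite !inE !negb_or => /and3P[/negbTE].
have ne' a : a \notin [:: 24; 25; out]%N -> (a == out)%N = false.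
  by rewrite !inE !negb_or => /and3P[_ _ /negbTE].
have s24 (j' : 'I_n) : rmem s2 24 j' = if before K j' i then h j' else l j'.
  have [e1 e2 _] := n0; have [f1 f2 f3] := n3.
  have lk : breads 24 (is_cell0 4) (before_exp key) by rewrite /= (ne _ _ keyP).
  have lh : rreads 24 (is_cell0 4) (entry 4 hi) by rewrite /= (ne _ _ hiP).
  have ll : rreads 24 (is_cell0 4) (entry 4 lo) by rewrite /= (ne _ _ loP).
  rewrite /s2 (run_update _ _ e1) //= /upd /= f1 !(E1 key) // (E1 hi) // !sK !sh.
  rewrite /s1 (run_fill _ _ s'n) //= /upd /= (E lo) // sl; congr (if _ then _ else _).
  by rewrite /before negb_and negbK -ltNge -ltnNge.
have s25 : rmem s3 25 0 = \sum_(j' < n) (if before K j' i then h j' else l j').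
  have [_ e2 _] := n0.
  rewrite /s3 (run_sum_into _ e2) //=; apply: eq_bigr => j' _.
  by rewrite /upd /= s24.
rewrite run_setr /=; set s4 := setr _ _ _ _.
have [_ _ f3] := n3.
have s4o j' : rmem s4 out j' = if j' == i then l i + d - \sum_(j' < n) (if before K j' i then h j' else l j')
     else rmem s' out j'.
  by rewrite /s4 /= /upd f3 eqxx /= Eo s25 !E3 // sl sd.
have E4 a : a \notin [:: 24; 25; out]%N -> rmem s4 a = rmem s a.
  by move=> aP; rewrite -E3 //; apply: upd_other; rewrite ne'.
have f4 : nmem s4 3 0 = i by [].
clearbody s4.
set raw := l i + d - _ in s4o.
set s5 := run _ s4.
have E5 a : a \notin [:: 24; 25; out]%N -> rmem s5 a = rmem s a.
  move=> aP; rewrite -E4 // /s5 rmem_run //=.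
  by move: aP; rewrite !inE !negb_or => /and3P[].
have f5 : nmem s5 3 0 = i by rewrite /s5 nmem_run.
rewrite (run_guarded_setr _ _ _ _ f5) /= f5 !(E5 lo) // sl.
rewrite /s5 !(run_guarded_setr _ _ _ _ f4) /= f4 !(E4 hi) // sh !s4o eqxx.
rewrite /greedy -/raw; case: eqP => //= _.
by case: (leP (h i) raw) => _; case: leP.
Qed.

(** Real arrays used by the algorithm. Indexed by path: the coefficients of the
    program of the current level, the flows [xmin_], [xmax_] and [z_], the
    candidate routing [human_], [auto_] and [queue_], and [empty_], first an
    indicator of empty ranges [[lo, hi]] and then the autonomy level of the
    candidate. The others are scalars stored in cell 0. Counters: 2 for the
    path that sets the level, 3 for the path being processed. *)
Notation gap_ := 12%N (only parsing).
Notation slack_ := 13%N (only parsing).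
Notation steep_ := 14%N (only parsing).
Notation lo_ := 15%N (only parsing).
Notation hi_ := 16%N (only parsing).
Notation low0_ := 17%N (only parsing).
Notation low1_ := 18%N (only parsing).
Notation up0_ := 19%N (only parsing).
Notation up1_ := 20%N (only parsing).
Notation spill_ := 21%N (only parsing).
Notation extra_ := 22%N (only parsing).
Notation zero_ := 23%N (only parsing).
Notation xmin_ := 26%N (only parsing).
Notation xmax_ := 27%N (only parsing).
Notation z_ := 28%N (only parsing).
Notation level_ := 29%N (only parsing).
Notation sum_lo_ := 30%N (only parsing).
Notation sum_hi_ := 31%N (only parsing).
Notation fmin_ := 32%N (only parsing).
Notation fmax_ := 33%N (only parsing).
Notation sum_spill_ := 34%N (only parsing).
Notation empty_ := 35%N (only parsing).
Notation sum_empty_ := 36%N (only parsing).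
Notation fbest_ := 37%N (only parsing).
Notation rest_ := 38%N (only parsing).
Notation theta_ := 39%N (only parsing).
Notation cost_ := 40%N (only parsing).
Notation best_ := 41%N (only parsing).
Notation human_ := 42%N (only parsing).
Notation auto_ := 43%N (only parsing).
Notation queue_ := 44%N (only parsing).

Definition freeflow_exp (v : nat) : rexp := (entry v 3 / entry v 0)%X.
Definition supply_exp : rexp := (entry 3 0 * entry 3 6)%X.
Definition slope_exp : rexp := (entry 3 1 / entry 3 2)%X.
Definition unit_queue_exp : rexp :=
  ((RConst 1 - entry 3 6 / entry 3 5) * entry 3 7
    / (entry 3 6 / entry 3 5 * entry 3 0 * entry 3 5))%X.
Definition slower_exp : bexp := BLt (rcell0 level_) (freeflow_exp 3).
Definition faster_exp : bexp := BLt (freeflow_exp 3) (rcell0 level_).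
Definition zero_exp : rexp := RConst 0.
Definition level_exp : rexp := rcell0 level_.

Definition prepare (controlled : bool) : prog :=
  Then (SetR level_ (NConst 0) (freeflow_exp 2))
  (Then (fill_if 3 gap_ zero_exp faster_exp (level_exp - freeflow_exp 3)%X)
  (Then (fill 3 slack_ (entry 3 4 * unit_queue_exp * supply_exp
           - entry 3 gap_ * (supply_exp / entry 3 2))%X)
  (Then (fill 3 steep_ (entry 3 gap_ * (RConst 1 - slope_exp))%X)
  (Then (fill_if 3 lo_ zero_exp
           (BAnd (BLt (entry 3 steep_) zero_exp) (BLt (entry 3 slack_) zero_exp))
           (entry 3 slack_ / entry 3 steep_)%X)
  (Then (fill_if 3 hi_ (supply_exp / entry 3 1)%X slower_exp zero_exp)
  (Then (update 3 hi_
           (BAnd (BLt zero_exp (entry 3 steep_))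
                 (BLt (entry 3 slack_ / entry 3 steep_)%X (entry 3 hi_)))
           (entry 3 slack_ / entry 3 steep_)%X)
  (Then (update 3 hi_
           (BAnd (BAnd (BLeR (entry 3 steep_) zero_exp)
                       (BLeR zero_exp (entry 3 steep_)))
                 (BLt (entry 3 slack_) zero_exp))
           (zero_exp - RConst 1)%X)
  (Then (fill_if 3 low0_ zero_exp faster_exp (supply_exp / entry 3 2)%X)
  (Then (fill_if 3 low1_ zero_exp faster_exp (zero_exp - slope_exp)%X)
  (Then (fill_if 3 up0_ (supply_exp / entry 3 2)%X slower_exp zero_exp)
  (Then (fill 3 up1_ slope_exp)
  (Then (fill_if 3 spill_ zero_exp slower_exp
           (supply_exp / entry 3 2 * RConst controlled)%X)
  (Then (fill_if 3 extra_ zero_exp slower_exp (freeflow_exp 3 - level_exp)%X)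
        (fill 3 zero_ zero_exp)))))))))))))).

Definition solve : prog :=
  Then (greedy_prog low1_ lo_ hi_ 8 xmin_)
  (Then (greedy_prog up1_ lo_ hi_ 8 xmax_)
  (Then (sum_into 3 sum_lo_ (entry 3 lo_))
  (Then (sum_into 3 sum_hi_ (entry 3 hi_))
  (Then (sum_into 3 fmin_ (entry 3 low0_ + entry 3 low1_ * entry 3 xmin_)%X)
  (Then (sum_into 3 fmax_ (entry 3 up0_ - entry 3 up1_ * entry 3 xmax_)%X)
  (Then (sum_into 3 sum_spill_ (entry 3 spill_))
  (Then (fill_if 3 empty_ zero_exp (BLt (entry 3 hi_) (entry 3 lo_)) (RConst 1))
  (Then (sum_into 3 sum_empty_ (entry 3 empty_))
  (Then (SetR fbest_ (NConst 0) (RRead 8 (NConst 1)))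
  (Then (Cond (BLeR (rcell0 fmax_) (rcell0 fbest_))
           (SetR fbest_ (NConst 0) (rcell0 fmax_)) Nop)
  (Then (SetR rest_ (NConst 0) (RRead 8 (NConst 1) - rcell0 fbest_)%X)
  (Then (SetR theta_ (NConst 0)
           ((rcell0 fbest_ - rcell0 fmin_) / (rcell0 fmax_ - rcell0 fmin_))%X)
  (Then (greedy_prog extra_ zero_ spill_ rest_ z_)
  (Then (fill 3 human_ (entry 3 xmin_
           + rcell0 theta_ * (entry 3 xmax_ - entry 3 xmin_))%X)
  (Then (fill 3 auto_ (entry 3 low0_ + entry 3 low1_ * entry 3 xmin_
           + rcell0 theta_ * (entry 3 up0_ - entry 3 up1_ * entry 3 xmax_
              - (entry 3 low0_ + entry 3 low1_ * entry 3 xmin_))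
           + entry 3 z_)%X)
  (Then (fill 3 empty_ (entry 3 auto_ / (entry 3 human_ + entry 3 auto_))%X)
  (Then (fill 3 queue_ (entry 3 gap_ /
           (unit_queue_exp * (entry 3 empty_ * entry 3 2
              + (RConst 1 - entry 3 empty_) * entry 3 1)))%X)
  (Then (sum_into 3 cost_ (entry 3 extra_ * entry 3 z_)%X)
        (SetR cost_ (NConst 0) (level_exp
           * (rcell0 8 + RRead 8 (NConst 1)) + rcell0 cost_)%X))))))))))))))))))).

Definition feasible_exp : bexp :=
  BAnd (BLeR (rcell0 sum_empty_) zero_exp)
  (BAnd (BLeR (rcell0 sum_lo_) (rcell0 8))
  (BAnd (BLeR (rcell0 8) (rcell0 sum_hi_))
  (BAnd (BLeR (rcell0 fmin_) (RRead 8 (NConst 1)))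
        (BLeR (RRead 8 (NConst 1)) (rcell0 fmax_ + rcell0 sum_spill_)%X)))).

(** Until a first candidate has been recorded, [best_] is meaningless and must
    not be compared with. *)
Definition better_exp : bexp :=
  BNot (BAnd (BLeN (NConst 1) (cell0 1)) (BLeR (rcell0 best_) (rcell0 cost_))).

Definition record : prog :=
  Cond (BAnd feasible_exp better_exp)
    (Then (SetN 1 (NConst 0) (NConst 1))
    (Then (SetR best_ (NConst 0) (rcell0 cost_))
    (Then (fill 3 9 (entry 3 human_))
    (Then (fill 3 10 (entry 3 auto_))
          (fill 3 11 (entry 3 queue_)))))) Nop.

(** Without paths no level is ever tried, and the empty routing is an
    equilibrium exactly when both demands vanish. *)
Definition best_equilibrium_prog (controlled : bool) : prog :=
  Then (Cond (BAnd (BLeN (cell0 0) (NConst 0))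
               (BAnd (BLeR (rcell0 8) zero_exp)
                     (BLeR (RRead 8 (NConst 1)) zero_exp)))
             (SetN 1 (NConst 0) (NConst 1)) Nop)
    (Loop 2 (Then (prepare controlled) (Then solve record))).

(** * Correctness of the algorithm *)

Section Verify.
Variables (R : realType) (n : nat) (P : network R n) (dh da : R) (controlled : bool).
Implicit Types (s : store R) (c : prog).

Record inputs s : Prop := Inputs {
  input_path : forall a (i : 'I_n), (a < 8)%N -> rmem s a i = path_data (P i) a;
  input_h : rmem s 8 0 = dh;
  input_a : rmem s 8 1 = da }.

Lemma inputs_run c s :
  all (fun a => a \notin rwrites c) (iota 0 9) -> inputs s -> inputs (run c s).
Proof.
move=> /allP cP [i1 i2 i3].
have ne a : (a < 9)%N -> a \notin rwrites c by move=> a9; apply: cP; rewrite mem_iota.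
by split=> [a i a8||]; rewrite rmem_run ?i1 // ne // ltnW.
Qed.

Lemma inputs_setn v i k s : inputs s -> inputs (setn s v i k).
Proof. by case. Qed.

Lemma inputE s (i : 'I_n) : inputs s ->
  ((rmem s 0 i = velocity (P i)) * (rmem s 1 i = headway_h (P i)) *
   (rmem s 2 i = headway_a (P i)) * (rmem s 3 i = (cells (P i))%:R) *
   (rmem s 4 i = (cells_n (P i))%:R) * (rmem s 5 i = (lanes_n (P i))%:R) *
   (rmem s 6 i = (lanes_b (P i))%:R) * (rmem s 7 i = jam_n (P i)))%type.
Proof. by move=> hs; rewrite !(input_path hs). Qed.

Lemma reval_freeflow s v (i : 'I_n) : inputs s -> nmem s v 0 = i ->
  reval s (freeflow_exp v) = freeflow_latency (P i).
Proof. by move=> hs vi; rewrite /= vi !(inputE i hs). Qed.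

Local Notation holds s a f := (forall i : 'I_n, rmem s a i = f i).

(** Symbolic execution of a sequence of commands: [unroll] exposes the commands,
    [enter s'] names the state after the next one, and [carry s'] transports to
    [s'] all known facts about arrays that this command does not write. *)
Ltac unroll := repeat match goal with
  | |- context [run (Then ?a ?b) ?s] => rewrite (run_then a b s) end.
Ltac enter s' := match goal with |- context [run ?c ?s] =>
  is_var s; set s' := run c s end.
Ltac carry s' := let e := eval cbv delta [s'] in s' in match e with
  run ?c ?s =>
    repeat match goal with
    | H : context [rmem s ?a] |- _ =>
        rewrite -(@rmem_run _ c s a isT : rmem s' a = rmem s a) in H
    | H : context [nmem s ?a] |- _ =>
        rewrite -(@nmem_run _ c s a isT : nmem s' a = nmem s a) in H
    | H : inputs s |- _ =>
        let H' := fresh in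
        have H' : inputs s' := @inputs_run c s isT H; clear H; rename H' into H
    end end.

Record prepared (L : R) s : Prop := Prepared {
  prep_inputs : inputs s;
  prep_size : nmem s 0 0 = n;
  prep_level : rmem s level_ 0 = L;
  prep_gap : holds s gap_ (fun i => gap L (P i));
  prep_lo : holds s lo_ (lo (candidate_lp P controlled L));
  prep_hi : holds s hi_ (hi (candidate_lp P controlled L));
  prep_low0 : holds s low0_ (low0 (candidate_lp P controlled L));
  prep_low1 : holds s low1_ (low1 (candidate_lp P controlled L));
  prep_up0 : holds s up0_ (up0 (candidate_lp P controlled L));
  prep_up1 : holds s up1_ (up1 (candidate_lp P controlled L));
  prep_spill : holds s spill_ (spill (candidate_lp P controlled L));
  prep_extra : holds s extra_ (extra (candidate_lp P controlled L));
  prep_zero : holds s zero_ (fun=> 0) }.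

Lemma run_prepare s (k : 'I_n) : inputs s -> nmem s 0 0 = n -> nmem s 2 0 = k ->
  prepared (freeflow_latency (P k)) (run (prepare controlled) s).
Proof.
move=> ins sn sk; set L := freeflow_latency (P k).
rewrite /prepare; unroll.
enter s1.
have level : rmem s1 level_ 0 = L.
  exact: (reval_freeflow ins sk).
carry s1; clearbody s1.
enter s2.
have gapE : holds s2 gap_ (fun i => gap L (P i)).
  move=> i; rewrite /s2 (run_fill_if _ _ sn) //= /upd /= level !(inputE i ins).
  by rewrite -ltNge.
carry s2; clearbody s2.
enter s3.
have slackE : holds s3 slack_ (fun i => slack L (P i)).
  by move=> i; rewrite /s3 (run_fill _ _ sn) //= /upd /= gapE !(inputE i ins).
carry s3; clearbody s3.
enter s4.
have steepE : holds s4 steep_ (fun i => steep L (P i)).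
  by move=> i; rewrite /s4 (run_fill _ _ sn) //= /upd /= gapE !(inputE i ins).
carry s4; clearbody s4.
enter s5.
have loE : holds s5 lo_ (lo (candidate_lp P controlled L)).
  move=> i; rewrite /s5 (run_fill_if _ _ sn) //= /upd /= slackE steepE.
  by rewrite -!ltNge.
carry s5; clearbody s5.
enter s6.
have allE : holds s6 hi_ (fun i => x_all L (P i)).
  move=> i; rewrite /s6 (run_fill_if _ _ sn) //= /upd /= level !(inputE i ins).
  by rewrite -!ltNge.
carry s6; clearbody s6.
enter s7.
have hiE' : holds s7 hi_ (fun i =>
    if (0 < steep L (P i)) && (slack L (P i) / steep L (P i) < x_all L (P i))
    then slack L (P i) / steep L (P i) else x_all L (P i)).
  move=> i; rewrite /s7 (run_update _ _ sn) //= /upd /= allE slackE steepE.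
  by rewrite -!ltNge.
carry s7; clearbody s7.
enter s8.
have hiE : holds s8 hi_ (hi (candidate_lp P controlled L)).
  move=> i; rewrite /s8 (run_update _ _ sn) //= /upd /= hiE' slackE steepE.
  by rewrite -!ltNge -eq_le /x_hi sub0r.
carry s8; clearbody s8.
enter s9.
have low0E : holds s9 low0_ (low0 (candidate_lp P controlled L)).
  move=> i; rewrite /s9 (run_fill_if _ _ sn) //= /upd /= level !(inputE i ins).
  by rewrite -!ltNge.
carry s9; clearbody s9.
enter s10.
have low1E : holds s10 low1_ (low1 (candidate_lp P controlled L)).
  move=> i; rewrite /s10 (run_fill_if _ _ sn) //= /upd /= level !(inputE i ins).
  by rewrite -!ltNge sub0r.
carry s10; clearbody s10.
enter s11.
have up0E : holds s11 up0_ (up0 (candidate_lp P controlled L)).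
  move=> i; rewrite /s11 (run_fill_if _ _ sn) //= /upd /= level !(inputE i ins).
  by rewrite -!ltNge.
carry s11; clearbody s11.
enter s12.
have up1E : holds s12 up1_ (up1 (candidate_lp P controlled L)).
  by move=> i; rewrite /s12 (run_fill _ _ sn) //= /upd /= !(inputE i ins).
carry s12; clearbody s12.
enter s13.
have spillE : holds s13 spill_ (spill (candidate_lp P controlled L)).
  move=> i; rewrite /s13 (run_fill_if _ _ sn) //= /upd /= level !(inputE i ins).
  by rewrite -!ltNge.
carry s13; clearbody s13.
enter s14.
have extraE : holds s14 extra_ (extra (candidate_lp P controlled L)).
  move=> i; rewrite /s14 (run_fill_if _ _ sn) //= /upd /= level !(inputE i ins).
  by rewrite -!ltNge.
carry s14; clearbody s14.
enter s15.
have zeroE : holds s15 zero_ (fun=> 0).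
  by move=> i; rewrite /s15 (run_fill _ _ sn).
carry s15; clearbody s15.
by split.
Qed.

Definition solution L : routing R n :=
  let D := candidate_lp P controlled L in
  plan_routing P L (best_x D dh da) (best_y D dh da) (best_z D dh da).

Definition solution_cost L : R :=
  let D := candidate_lp P controlled L in
  L * (dh + da) + lp_cost D (best_z D dh da).

Record stores (h a q : nat) (r : routing R n) s : Prop := Stores {
  stores_h : holds s h (flow_h r);
  stores_a : holds s a (flow_a r);
  stores_q : holds s q (congested r) }.

Record solved (L : R) s : Prop := Solved {
  solved_inputs : inputs s;
  solved_size : nmem s 0 0 = n;
  solved_routing : stores human_ auto_ queue_ (solution L) s;
  solved_cost : rmem s cost_ 0 = solution_cost L;
  solved_feasible : beval s feasible_exp = lp_feasible (candidate_lp P controlled L) dh da }.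

Lemma run_solve s L : prepared L s -> solved L (run solve s).
Proof.
case=> ins sn level gapE loE hiE low0E low1E up0E up1E spillE extraE zeroE.
set D := candidate_lp P controlled L in loE hiE low0E low1E up0E up1E spillE extraE *.
have dhE := input_h ins; have daE := input_a ins.
rewrite /solve; unroll.
enter s1.
have xminE : holds s1 xmin_ (xmin D dh) by exact: run_greedy.
carry s1; clearbody s1.
enter s2.
have xmaxE : holds s2 xmax_ (xmax D dh) by exact: run_greedy.
carry s2; clearbody s2.
enter s3.
have sum_loE : rmem s3 sum_lo_ 0 = \sum_i lo D i.
  by rewrite /s3 (run_sum_into _ sn) //; apply: eq_bigr => i _; rewrite -loE.
carry s3; clearbody s3.
enter s4.
have sum_hiE : rmem s4 sum_hi_ 0 = \sum_i hi D i.
  by rewrite /s4 (run_sum_into _ sn) //; apply: eq_bigr => i _; rewrite -hiE.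
carry s4; clearbody s4.
enter s5.
have fminE : rmem s5 fmin_ 0 = fmin D dh.
  rewrite /s5 (run_sum_into _ sn) //; apply: eq_bigr => i _.
  by rewrite -xminE -low0E -low1E.
carry s5; clearbody s5.
enter s6.
have fmaxE : rmem s6 fmax_ 0 = fmax D dh.
  rewrite /s6 (run_sum_into _ sn) //; apply: eq_bigr => i _.
  by rewrite -xmaxE -up0E -up1E.
carry s6; clearbody s6.
enter s7.
have sum_spillE : rmem s7 sum_spill_ 0 = \sum_i spill D i.
  by rewrite /s7 (run_sum_into _ sn) //; apply: eq_bigr => i _; rewrite -spillE.
carry s7; clearbody s7.
enter s8.
have emptyE : holds s8 empty_ (fun i => (~~ (lo D i <= hi D i))%:R).
  move=> i; rewrite /s8 (run_fill_if _ _ sn) //= /upd /= loE hiE.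
  by case: (_ <= _).
carry s8; clearbody s8.
enter s9.
have sum_emptyE : rmem s9 sum_empty_ 0 = \sum_i (~~ (lo D i <= hi D i))%:R.
  by rewrite /s9 (run_sum_into _ sn) //; apply: eq_bigr => i _; rewrite -emptyE.
carry s9; clearbody s9.
enter s10.
have fbestE0 : rmem s10 fbest_ 0 = da by rewrite -daE.
carry s10; clearbody s10.
enter s11.
have fbestE : rmem s11 fbest_ 0 = fbest D dh da.
  rewrite /s11 run_cond /= fbestE0 fmaxE /fbest.
  by case: leP => _; rewrite ?run_setr /run //= /upd /=.
carry s11; clearbody s11.
enter s12.
have restE : rmem s12 rest_ 0 = da - fbest D dh da by rewrite -fbestE -daE.
carry s12; clearbody s12.
enter s13.
have thetaE : rmem s13 theta_ 0 = theta D dh da.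
  by rewrite /theta -fbestE -fminE -fmaxE.
carry s13; clearbody s13.
enter s14.
have zE : holds s14 z_ (best_z D dh da) by exact: run_greedy.
carry s14; clearbody s14.
enter s15.
have humanE : holds s15 human_ (best_x D dh da).
  move=> i; rewrite /s15 (run_fill _ _ sn) //= /upd /=.
  by rewrite thetaE xminE xmaxE.
carry s15; clearbody s15.
enter s16.
have autoE : holds s16 auto_ (fun i => best_y D dh da i + best_z D dh da i).
  move=> i; rewrite /s16 (run_fill _ _ sn) //= /upd /=.
  by rewrite thetaE low0E low1E up0E up1E xminE xmaxE zE.
carry s16; clearbody s16.
clear emptyE.
enter s17.
have levelE : holds s17 empty_ (fun i =>
    autonomy (best_x D dh da i) (best_y D dh da i + best_z D dh da i)).
  by move=> i; rewrite /s17 (run_fill _ _ sn) //= /upd /= humanE autoE.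
carry s17; clearbody s17.
enter s18.
have queueE : holds s18 queue_ (congested
    (plan_routing P L (best_x D dh da) (best_y D dh da) (best_z D dh da))).
  move=> i; rewrite /s18 (run_fill _ _ sn) //= /upd /= gapE levelE !(inputE i ins).
  by rewrite congestion_latencyE.
carry s18; clearbody s18.
enter s19.
have costE : rmem s19 cost_ 0 = lp_cost D (best_z D dh da).
  rewrite /s19 (run_sum_into _ sn) //; apply: eq_bigr => i _.
  by rewrite -zE -extraE.
carry s19; clearbody s19.
enter s20.
have costE' : rmem s20 cost_ 0 = L * (dh + da) + lp_cost D (best_z D dh da).
  by rewrite -costE -level -dhE -daE.
carry s20; clearbody s20.
split=> //=.
rewrite sum_emptyE sum_loE sum_hiE dhE daE fminE fmaxE sum_spillE.
congr (_ && _); apply/idP/forallP => [|h]; last first.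
  by rewrite big1 // => i _; rewrite h.
move=> e0 i; apply: contraTT e0 => h; rewrite -ltNge (bigD1 i) //= h.
by rewrite ltr_pwDl // sumr_ge0.
Qed.

Local Notation ff k := (freeflow_latency (P k)).
Local Notation feasible L := (lp_feasible (candidate_lp P controlled L) dh da).

(** The candidate replaces the output only if it is strictly cheaper, or if
    nothing has been output so far. *)
Lemma run_record s L : solved L s ->
  let s' := run record s in
  if feasible L && ((nmem s 1 0 == 0%N) || (solution_cost L < rmem s best_ 0))
  then [/\ nmem s' 1 0 = 1%N, rmem s' best_ 0 = solution_cost L & stores 9 10 11 (solution L) s']
  else s' = s.
Proof.
case=> ins sn [hE aE qE] costE feasE.
have better : beval s better_exp =
    (nmem s 1 0 == 0%N) || (solution_cost L < rmem s best_ 0).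
  by rewrite /= costE negb_and -ltNge -eqn0Ngt.
have test : beval s (BAnd feasible_exp better_exp) =
    feasible L && ((nmem s 1 0 == 0%N) || (solution_cost L < rmem s best_ 0)).
  by rewrite -feasE -better.
rewrite /= /record run_cond test; case: (_ && _) => //.
unroll.
enter s1.
have flag : nmem s1 1 0 = 1%N by [].
have s1n : nmem s1 0 0 = n by [].
carry s1; clearbody s1.
enter s2.
have bestE : rmem s2 best_ 0 = solution_cost L by rewrite -costE.
carry s2; clearbody s2.
enter s3.
have outh (i : 'I_n) : rmem s3 9 i = flow_h (solution L) i.
  by rewrite /s3 (run_fill _ _ s1n) //= /upd /= hE.
carry s3; clearbody s3.
enter s4.
have outa (i : 'I_n) : rmem s4 10 i = flow_a (solution L) i.
  by rewrite /s4 (run_fill _ _ s1n) //= /upd /= aE.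
carry s4; clearbody s4.
enter s5.
have outq (i : 'I_n) : rmem s5 11 i = congested (solution L) i.
  by rewrite /s5 (run_fill _ _ s1n) //= /upd /= qE.
carry s5; clearbody s5.
by split=> //; split.
Qed.

(** After the first [m] levels the output is the best of their feasible
    candidates, if there is any. *)
Definition searched (m : nat) s : Prop :=
  inputs s /\
  ((nmem s 1 0 = 0%N /\ forall k : 'I_n, (k < m)%N -> ~~ feasible (ff k)) \/
   (nmem s 1 0 = 1%N /\ exists k0, [/\ feasible (ff k0),
      rmem s best_ 0 = solution_cost (ff k0), stores 9 10 11 (solution (ff k0)) s
    & forall k : 'I_n, (k < m)%N -> feasible (ff k) -> solution_cost (ff k0) <= solution_cost (ff k)])).

Lemma run_search s : inputs s -> nmem s 0 0 = n -> nmem s 1 0 = 0%N ->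
  searched n (run (Loop 2 (Then (prepare controlled) (Then solve record))) s).
Proof.
move=> ins sn fl; apply: run_loop => //.
  by split; [exact: inputs_setn|left].
move=> k s' [_ fn] sk [ins' IH].
have s'n : nmem s' 0 0 = n by rewrite fn.
rewrite 2!run_then.
have prep := run_prepare ins' s'n sk.
have solv := run_solve prep.
have rec := run_record solv.
set s2 := run solve _ in rec solv *.
have keep a : a \notin rwrites (Then (prepare controlled) solve) -> rmem s2 a = rmem s' a.
  by move=> aP; rewrite /s2 -run_then rmem_run.
have keepf : nmem s2 1 = nmem s' 1 by rewrite /s2 -run_then nmem_run.
clearbody s2.
have ins3 : inputs (run record s2).
  exact: (inputs_run (c := record) isT (solved_inputs solv)).
rewrite /= keepf keep // in rec.
have stk r : stores 9 10 11 r s' -> stores 9 10 11 r s2.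
  case=> h1 h2 h3; split=> i.
  - by rewrite (keep 9%N isT).
  - by rewrite (keep 10%N isT).
  - by rewrite (keep 11%N isT).
suff [_ IH'] : searched k.+1 (run record s2).
  split; [exact: inputs_setn|rewrite nmem_tick //].
  case: IH' => [h|[h1 [k0 [h2 h3 [h4 h5 h6] h7]]]]; [by left|right; split=> //].
  by exists k0; split.
split=> //; move: rec; case: ifP => [/andP[fk better] [-> -> st]|worse ->].
  right; split=> //; exists k; split=> // j; rewrite ltnS leq_eqVlt.
  case/orP=> [/eqP/val_inj->//|jk fj].
  case: IH => [[_ /(_ j jk)]|[fl1 [k0 [_ bestE _ /(_ j jk fj)]]]].
    by rewrite fj.
  by apply: le_trans; move: better; rewrite fl1 bestE => /ltW.
rewrite keepf keep //; case: IH => [[fl0 none]|[fl1 [k0 [f0 bestE st0 min0]]]].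
  left; split=> // j; rewrite ltnS leq_eqVlt => /orP[/eqP/val_inj->|/none//].
  by move: worse; rewrite fl0 eqxx andbT => ->.
right; split=> //; exists k0; split=> //; first exact: stk.
move=> j; rewrite ltnS leq_eqVlt => /orP[/eqP/val_inj->|/min0//] fk.
by move: worse; rewrite fk fl1 bestE /= ltNge => /negbFE.
Qed.

End Verify.

Lemma inputs_input_store (R : realType) n (P : network R n) dh da :
  inputs P dh da (input_store P dh da).
Proof.
split=> // a i a8; rewrite /= valK.
by rewrite ltn_eqF.
Qed.

Section Correct.
Variables (R : realType) (controlled : bool) (selfish : R -> R -> bool).
Hypothesis selfishE :
  forall fh fa, selfish fh fa = (0 < fh) || (~~ controlled && (0 < fa)).

(** Every equilibrium costs at least as much as a plan at some level, hence as
    the best plan at that level, hence as the best plan overall. *)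
Lemma best_solution n (P : network R n) dh da (k0 : 'I_n) :
  let feasible k := lp_feasible (candidate_lp P controlled (freeflow_latency (P k))) dh da in
  let cost k := solution_cost P dh da controlled (freeflow_latency (P k)) in
  feasible k0 -> (forall k, feasible k -> cost k0 <= cost k) ->
  best_equilibrium P selfish dh da
    (solution P dh da controlled (freeflow_latency (P k0))).
Proof.
move=> feasible cost f0 min0.
have ok L : lp_ok (candidate_lp P controlled L) by exact: candidate_ok.
have [eq0 cost0] := plan_equilibrium selfishE (best_plan (ok _) f0).
split=> // y eqy.
have n0 : (0 < n)%N by exact: leq_ltn_trans (ltn_ord k0).
have [k [x [y' [z [pl le_cost]]]]] := equilibrium_plan selfishE n0 eqy.
have [fk cz] := plan_best (ok _) pl.
rewrite /solution cost0; apply: le_trans (min0 k fk) _.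
by apply: le_trans le_cost; rewrite lerD2l.
Qed.

Lemma no_paths (P : network R 0) dh da r :
  equilibrium P selfish dh da r <-> dh = 0 /\ da = 0.
Proof.
split=> [[[<- <- _] _]|[-> ->]]; first by rewrite !big_ord0.
by split=> [|[]//]; split; rewrite ?big_ord0 // => -[].
Qed.

Lemma run_correct n (P : network R n) dh da : 0 <= dh -> 0 <= da ->
  correct_output selfish P dh da
    (run (best_equilibrium_prog controlled) (input_store P dh da)).
Proof.
move=> dh0 da0; have ins := inputs_input_store P dh da.
rewrite /best_equilibrium_prog run_then run_cond /=.
case: (posnP n) => [n0|n0].
  subst n.
  case: ifP => [/and3P[_ h a]|ha].
    left; split=> //.
    have e : dh = 0 /\ da = 0 by split; apply/eqP; rewrite eq_le ?h ?a.
    split=> [|y _]; last by rewrite /total_latency !big_ord0.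
    exact/no_paths.
  right; split=> // x /no_paths[h a].
  by move: ha; rewrite h a lexx.
rewrite leqNgt n0 /= -[run Nop _]/(input_store P dh da).
have [_ IH] := run_search controlled ins (erefl : nmem (input_store P dh da) 0 0 = n) erefl.
move: (run _ _) IH => s [[flag none]|[flag [k0 [f0 _ st min0]]]].
  right; split=> // x eqx.
  have [k [y [y' [z [pl _]]]]] := equilibrium_plan selfishE n0 eqx.
  have [fk _] := plan_best (candidate_ok P controlled _) pl.
  by have := none k (ltn_ord k); rewrite fk.
left; split=> //.
have -> : output_routing n s = solution P dh da controlled (freeflow_latency (P k0)).
  by case: st => h a q; congr Routing; apply/funext => i; rewrite ?h ?a ?q.
by apply: best_solution => // k fk; exact: min0 (ltn_ord k) fk.
Qed.

Lemma best_equilibrium_prog_correct :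
  computes_best_equilibrium selfish (compile (best_equilibrium_prog controlled))
    (steps (best_equilibrium_prog controlled)).
Proof.
move=> n P dh da _ dh0 da0.
have [|//|t [x t_le]] := @exec_run R (best_equilibrium_prog controlled) (input_store P dh da) n.
  by [].
by exists (run (best_equilibrium_prog controlled) (input_store P dh da)), t; split=> //; exact: run_correct.
Qed.

End Correct.

(** The logarithm is bounded below by [ln 2] for [n >= 2], and [n + 1 <= 2 * n]
    gives the factor 8. *)
Lemma bigO_cube (R : realType) (T : nat -> nat) (C : nat) :
  (forall n, T n <= C * n.+1 ^ 3)%N ->
  (fun n : nat => (T n)%:R : R^o) =O_\oo
    (fun n : nat => n%:R ^+ 3 * ln n%:R : R^o).
Proof.
move=> h; apply/eqO_exP.
have ln2 : 0 < ln (2 : R) by rewrite ln_gt0 // ltr1n.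
exists ((8 * C)%N.+1%:R / ln 2); first by rewrite divr_gt0 // ltr0Sn.
near=> n.
have n2 : (2 <= n)%N by near: n; exists 2%N.
have n0 : 0 < n%:R :> R by rewrite ltr0n; exact: leq_trans n2.
have ln_n : ln (2 : R) <= ln n%:R by rewrite ler_ln ?posrE ?ler_nat.
rewrite ger0_norm ?ler0n // ger0_norm; last first.
  by rewrite mulr_ge0 ?exprn_ge0 ?ler0n // (le_trans (ltW ln2)).
apply: (@le_trans _ _ ((8 * C)%N.+1%:R * n%:R ^+ 3)).
  rewrite -natrX -natrM ler_nat; apply: (leq_trans (h n)).
  have : (n.+1 ^ 3 <= 8 * n ^ 3)%N by rewrite (_ : 8 = 2 ^ 3)%N // -expnMn leq_exp2r //; lia.
  move: (n.+1 ^ 3)%N (n ^ 3)%N => x y; nia.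
rewrite -mulrA ler_wpM2l ?ler0n // mulrCA ler_peMr ?exprn_ge0 ?ler0n //.
by rewrite mulrC ler_pdivlMr // mul1r.
Unshelve. all: by end_near.
Qed.

Theorem theorem2 (R : realType) :
  (exists (c : cmd) (T : nat -> nat),
     (fun n : nat => (T n)%:R : R^o) =O_\oo
       (fun n : nat => n%:R ^+ 3 * ln n%:R : R^o) /\
     computes_best_equilibrium (@all_selfish R) c T) /\
  (exists (c : cmd) (T : nat -> nat),
     (fun n : nat => (T n)%:R : R^o) =O_\oo
       (fun n : nat => n%:R ^+ 3 * ln n%:R : R^o) /\
     computes_best_equilibrium (@humans_selfish R) c T).
Proof.
(* Part (i) is [controlled = false], part (ii) is [controlled = true]. *)
have solves controlled (S : R -> R -> bool) :
    (forall fh fa, S fh fa = (0 < fh) || (~~ controlled && (0 < fa))) ->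
    exists (c : cmd) (T : nat -> nat),
      (fun n : nat => (T n)%:R : R^o) =O_\oo
        (fun n : nat => n%:R ^+ 3 * ln n%:R : R^o) /\
      computes_best_equilibrium S c T.
  move=> SE; have [C leC] := steps_poly (best_equilibrium_prog controlled).
  exists (compile (best_equilibrium_prog controlled)), (steps (best_equilibrium_prog controlled)).
  split; first by apply: (@bigO_cube _ _ C) => n; exact: leC.
  exact: best_equilibrium_prog_correct.
split; first exact: (solves false).
by apply: (solves true) => fh fa; rewrite orbF.
Qed.
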